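(* Let $n\ge1$ and let ${\bf p}=(p_1,\ldots,p_n)$, ${\bf q}=(q_1,\ldots,q_n)$ with $1<p_j<\infty$ and $0<q_j\le\infty$ for $j=1,\ldots,n$. Let ${\bf p}'=(p_1',\ldots,p_n')$, $p_j'=\frac{p_j}{p_j-1}$. There is a constant $c>0$, independent of $f$, such that if $f\in L^*_{{\bf p},{\bf q}}(\mathbb R^n)$, then $\widehat f\in N_{{\bf p}',{\bf q}}(M)$ and $$\|\widehat f\|_{N_{{\bf p}',{\bf q}}(M)}\le c\,\|f\|_{L^*_{{\bf p},{\bf q}}(\mathbb R^n)}.$$
   Context: The Fourier transform of $f\in L_1(\mathbb R^n)$ is $\widehat f(y)=\int_{\mathbb R^n}f(x)e^{-i(y,x)}\,dx$, where $(y,x)=\sum_{i=1}^n y_ix_i$. For general $f\in L^*_{{\bf p},{\bf q}}(\mathbb R^n)$ the Fourier transform is understood in the sense of tempered distributions, and for a parallelepiped $Q$ the integral $\int_Q\widehat f(x)\,dx$ is understood as $\int_{\mathbb R^n}f(y)\left(\int_Q e^{-i(x,y)}\,dx\right)dy$ (which equals the ordinary integral when $f\in L_1$). Rearrangements: for a measurable function $g$ of one real variable, $g^*(t)=\inf\{\sigma:\ \mu\{x:\ |g(x)|>\sigma\}\le t\}$, $t>0$, with $\mu$ the Lebesgue measure. For measurable $f$ on $\mathbb R^n$ and fixed $x_2,\ldots,x_n$, $f^{*_1}(t_1,x_2,\ldots,x_n)$ is the non-increasing rearrangement of $x_1\mapsto f(x_1,\ldots,x_n)$; then $f^{*_1*_2}(t_1,t_2,x_3,\ldots,x_n)$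 is the non-increasing rearrangement of $x_2\mapsto f^{*_1}(t_1,x_2,\ldots,x_n)$; continuing, after $n$ steps one obtains the repeated rearrangement $f^{*_1\ldots*_n}(t_1,\ldots,t_n)$. For vectors ${\bf p}=(p_1,\ldots,p_n)$, ${\bf q}=(q_1,\ldots,q_n)$ with $1<p_j<\infty$ and $0<q_j\le\infty$ for $j=1,\ldots,n$, define, for functions $\varphi$ on $(0,\infty)^n$, $$\Phi_{{\bf p},{\bf q}}(\varphi)=\left(\int_0^\infty\ldots\left(\int_0^\infty\left|t_1^{\frac1{p_1}}\ldots t_n^{\frac1{p_n}}\varphi(t_1,\ldots,t_n)\right|^{q_1}\frac{dt_1}{t_1}\right)^{\frac{q_2}{q_1}}\ldots\frac{dt_n}{t_n}\right)^{\frac1{q_n}},$$ where for $q=\infty$ the expression $\left(\int_0^\infty (G(t))^q\frac{dt}{t}\right)^{1/q}$ is understood as $\sup_{t>0}G(t)$. The anisotropic Lorentz space $L^*_{{\bf p},{\bf q}}(\mathbb R^n)$ is the set of measurable functions $f$ with $\|f\|_{L^*_{{\bf p},{\bf q}}(\mathbb R^n)}=\Phi_{{\bf p},{\bf q}}(f^{*_1\ldots*_n})<\infty$. $M$ is the set of all parallelepipeds $Q=Q_1\times\ldots\times Q_n$, where the $Q_i$ are (bounded, nondegenerate) segments in $\mathbb R$; $|Q_j|$ is the length of $Q_j$ and $|Q|$ the volume of $Q$. For $g$ integrable on each $Q\in M$ (or, for $g=\widehat f$ with $f\in L^*_{{\bf p},{\bf q}}(\mathbb R^n)$, with the integral $\int_Q\widehat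 f(x)\,dx$ understood as $\int_{\mathbb R^n}f(y)\left(\int_Q e^{-i(x,y)}\,dx\right)dy$), put $$\bar g(t_1,\ldots,t_n;M)=\sup_{Q\in M,\ |Q_j|>t_j,\ j=1,\ldots,n}\frac1{|Q|}\left|\int_Q g(x)\,dx\right|,$$ and $g\in N_{{\bf p},{\bf q}}(M)$ means $\|g\|_{N_{{\bf p},{\bf q}}(M)}=\Phi_{{\bf p},{\bf q}}(\bar g(\cdot;M))<\infty$. *)

(* Defs.v *)
From HB Require Import structures.
From mathcomp Require Import all_boot all_order all_algebra.
From mathcomp Require Import complex.
From mathcomp Require Import all_classical all_reals all_analysis.
From mathcomp Require Import measurable_realfun.

Set Implicit Arguments.
Unset Strict Implicit.
Unset Printing Implicit Defensive.

Import Order.TTheory GRing.Theory Num.Theory.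
Import numFieldNormedType.Exports.

Local Open Scope classical_set_scope.
Local Open Scope ring_scope.

Section lebesgue_measure_rn.
Context (R : realType).

Definition tcons (T : Type) n (x : T * n.-tuple T) : n.+1.-tuple T :=
  [tuple of x.1 :: x.2].

Lemma measurable_tcons n :
  measurable_fun [set: measurableTypeR R * n.-tuple R] (@tcons R n).
Proof. by apply: (@measurable_cons _ _ _ R fst n snd). Qed.

Section cons_measure.
Context (n : nat) (mu : {sigma_finite_measure set (n.-tuple R) -> \bar R}).

Definition cons_measure : set (n.+1.-tuple R) -> \bar R :=
  pushforward (lebesgue_measure \x mu)%E (@tcons R n).

Let cons_measure0 : cons_measure set0 = 0%E.
Proof. by rewrite /cons_measure /pushforward preimage_set0 measure0. Qed.

Let cons_measure_ge0 A : (0 <= cons_measure A)%E.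
Proof. by rewrite /cons_measure /pushforward; exact: measure_ge0. Qed.

Let cons_measure_sigma_additive : semi_sigma_additive cons_measure.
Proof.
move=> F mF tF mUF; rewrite /cons_measure /pushforward preimage_bigcup.
have mc A : measurable A -> measurable (@tcons R n @^-1` A).
  by move=> mA; rewrite -[X in measurable X]setTI; exact: measurable_tcons.
apply: measure_semi_sigma_additive.
- by move=> k; exact: mc.
- apply/trivIsetP => /= i j _ _ ij; rewrite -preimage_setI.
  by move/trivIsetP : tF => /(_ _ _ _ _ ij) ->//; rewrite preimage_set0.
- by rewrite -preimage_bigcup; exact: mc.
Qed.

HB.instance Definition _ := isMeasure.Build _ _ _ cons_measure
  cons_measure0 cons_measure_ge0 cons_measure_sigma_additive.

Let cons_measure_sigma_finite : sigma_finite setT cons_measure.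
Proof.
have /sigma_finiteP[F [TF ndF Foo]] := sigma_finiteT (@lebesgue_measure R).
have /sigma_finiteP[G [TG ndG Goo]] := sigma_finiteT mu.
pose u (x : n.+1.-tuple R) : measurableTypeR R * n.-tuple R :=
  (thead x, [tuple of behead x]).
have mu_ : measurable_fun setT u.
  apply/measurable_fun_pairP; split => /=.
    exact: (@measurable_tnth _ R n.+1 ord0).
  exact: measurable_behead.
have uK : cancel (@tcons R n) u.
  by case=> x y; rewrite /u /tcons theadE; congr pair; exact/val_inj.
exists (fun k => u @^-1` (F k `*` G k)).
  rewrite -preimage_bigcup -(preimage_setT u); congr (_ @^-1` _).
  rewrite -setXTT TF TG predeqE => -[x y]; split.
    move=> [/= [k _ Fkx] [l _ Gly]]; exists (maxn k l) => //; split.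
    - by move: x Fkx; exact/subsetPset/ndF/leq_maxl.
    - by move: y Gly; exact/subsetPset/ndG/leq_maxr.
  by move=> [k _ []/= ? ?]; split; exists k.
move=> k; have [mF Fk] := Foo k; have [mG Gk] := Goo k.
have mFG : measurable (F k `*` G k) by exact: measurableX.
split; first by rewrite -[X in measurable X]setTI; exact: mu_.
rewrite /cons_measure /pushforward -comp_preimage.
rewrite (_ : u \o _ = id) ?preimage_id; last by apply/funext => x; exact: uK.
by rewrite product_measure1E// lte_mul_pinfty// ge0_fin_numE.
Qed.

HB.instance Definition _ := @Measure_isSigmaFinite.Build _ _ _
  cons_measure cons_measure_sigma_finite.

End cons_measure.

(* Lebesgue measure on R^n, as the image of the n-fold product measure *)
Fixpoint lebesgue_rn (n : nat) :
    {sigma_finite_measure set (n.-tuple R) -> \bar R} :=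
  match n with
  | 0 => \d_([tuple] : 0.-tuple R)
  | m.+1 => cons_measure (lebesgue_rn m)
  end.

End lebesgue_measure_rn.

Section complex_integration.
Context (R : realType) (n : nat).
Implicit Types (A : set (n.-tuple R)) (F : n.-tuple R -> R[i]).

(* [measurable] is the Borel sigma-algebra of R^n; Lebesgue measurability is
   measurability with respect to its completion. *)
Definition lebesgue_measurable (f : n.-tuple R -> R) :=
  forall B : set R, measurable B ->
    completed_algebra_gen (lebesgue_rn R n) (f @^-1` B).

Definition clebesgue_measurable F :=
  lebesgue_measurable (fun x => complex.Re (F x)) /\
  lebesgue_measurable (fun x => complex.Im (F x)).

(* The library's integral of a nonnegative function is the supremum of the
   integrals of the Borel simple functions below it, so it agrees with the
   integral against the completed measure on Lebesgue measurable functions;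
   the library's [integrable] would require Borel measurability. *)
Definition cintegrable F :=
  clebesgue_measurable F /\
  (\int[lebesgue_rn R n]_x (Normc.normc (F x))%:E < +oo)%E.

Definition cintegral A F : R[i] :=
  Complex (\int[lebesgue_rn R n]_(x in A) complex.Re (F x))
          (\int[lebesgue_rn R n]_(x in A) complex.Im (F x)).

End complex_integration.

Section fourier.
Context (R : realType) (n : nat).
Implicit Types (f : n.-tuple R -> R[i]) (x y a b : n.-tuple R).

Definition dot y x : R := \sum_(j < n) tnth y j * tnth x j.

(* exp (- i s) *)
Definition expNi (s : R) : R[i] := Complex (cos s) (- sin s).

Definition box a b : set (n.-tuple R) :=
  [set x | forall j, tnth a j <= tnth x j <= tnth b j].

Definition fourier_integrand f (Q : set (n.-tuple R)) y : R[i] :=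
  f y * cintegral Q (fun x => expNi (dot x y)).

(* The integral over Q of the Fourier transform of f, that is, the value at the
   indicator function of Q of the distribution [phi |-> int f * phi^] *)
Definition fourier_integral f (Q : set (n.-tuple R)) : R[i] :=
  cintegral setT (fourier_integrand f Q).

End fourier.

Section rearrangement.
Context (R : realType).
Local Open Scope ereal_scope.

(* [lebesgue_measure] is the restriction to Borel sets of an outer measure, and
   is that outer measure on the other sets; so it has the right value on
   every Lebesgue measurable set. *)
Definition rearrange1 (g : R -> \bar R) (t : R) : \bar R :=
  ereal_inf [set s%:E | s in
    [set s : R | lebesgue_measure [set x : R | s%:E < `|g x|] <= t%:E]].

(* The first coordinate is rearranged first. *)
Fixpoint rearrange (n : nat) : (n.-tuple R -> \bar R) -> n.-tuple R -> \bar R :=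
  match n with
  | 0 => fun g => g
  | m.+1 => fun g t =>
      rearrange (fun x' => rearrange1 (fun x1 => g (tcons (x1, x'))) (thead t))
                [tuple of behead t]
  end.

End rearrangement.

Section mixed_norms.
Context (R : realType).
Local Open Scope ereal_scope.

(* L_q quasi-norm of G >= 0 with respect to dt/t on (0, +oo); only 0 < q is
   meaningful. *)
Definition Lq_haar (q : \bar R) (G : R -> \bar R) : \bar R :=
  match q with
  | r%:E => (\int[lebesgue_measure]_(t in `]0%R, +oo[)
               (G t `^ r * (t^-1)%:E)) `^ r^-1
  | +oo => ereal_sup [set G t | t in [set t : R | (0 < t)%R]]
  | -oo => 0
  end.

(* The innermost norm is taken in the first coordinate. *)
Fixpoint mixed_norm (n : nat) :
    n.-tuple (\bar R) -> (n.-tuple R -> \bar R) -> \bar R :=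
  match n with
  | 0 => fun _ G => G [tuple]
  | m.+1 => fun q G =>
      mixed_norm [tuple of behead q]
        (fun t' => Lq_haar (thead q) (fun t1 => G (tcons (t1, t'))))
  end.

Definition Phi n (p : n.-tuple R) (q : n.-tuple (\bar R))
    (phi : n.-tuple R -> \bar R) : \bar R :=
  mixed_norm q (fun t =>
    `| (\prod_(j < n) (tnth t j `^ (tnth p j)^-1)%R)%:E * phi t |).

End mixed_norms.

Section spaces.
Context (R : realType) (n : nat) (p : n.-tuple R) (q : n.-tuple (\bar R)).
Local Open Scope ereal_scope.

Definition lorentz_norm (f : n.-tuple R -> R[i]) : \bar R :=
  Phi p q (rearrange (fun x => (Normc.normc (f x))%:E)).

Definition in_lorentz (f : n.-tuple R -> R[i]) :=
  clebesgue_measurable f /\ lorentz_norm f < +oo.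

(* Below, J Q stands for the integral of g over the parallelepiped Q; the net
   space norm depends on g only through J. *)
Definition avg_sup (J : set (n.-tuple R) -> R[i]) (t : n.-tuple R) : \bar R :=
  ereal_sup
    [set ((\prod_(j < n) (tnth ab.2 j - tnth ab.1 j))^-1 *
          Normc.normc (J (box ab.1 ab.2)))%:E |
      ab in [set ab : n.-tuple R * n.-tuple R | forall j,
        (tnth ab.1 j < tnth ab.2 j)%R /\
        (tnth t j < tnth ab.2 j - tnth ab.1 j)%R]].

Definition net_norm (J : set (n.-tuple R) -> R[i]) : \bar R :=
  Phi p q (avg_sup J).

Definition fourier_in_net (f : n.-tuple R -> R[i]) :=
  (forall a b : n.-tuple R, (forall j, (tnth a j < tnth b j)%R) ->
     cintegrable (fourier_integrand f (box a b))) /\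
  net_norm (fourier_integral f) < +oo.

End spaces.

Definition conj_exp (R : realType) n (p : n.-tuple R) : n.-tuple R :=
  [tuple tnth p j / (tnth p j - 1) | j < n].

(* Main.v *)
Require Import Defs.
From mathcomp Require Import all_boot all_order all_algebra.
From mathcomp Require Import complex.
From mathcomp Require Import all_classical all_reals all_analysis.
From mathcomp Require Import measurable_realfun.
From mathcomp Require Import ring lra.

Set Implicit Arguments.
Unset Strict Implicit.
Unset Printing Implicit Defensive.

Import Order.TTheory GRing.Theory Num.Theory.
Import numFieldNormedType.Exports.

Local Open Scope classical_set_scope.
Local Open Scope ring_scope.

(** The Fourier integral of the indicator function of a box Q with sides l_j is
   a product of one-dimensional oscillatory integrals, so at y it is at most
   2^n |Q| prod_j min(1, 2 / (l_j |y_j|)) in modulus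
   ([normc_box_kernel_le]).  Since this product decreases when a side grows, the
   averages of the transform of f over all the boxes with sides larger than
   t_j are controlled by
      U(t) = int |f(y)| prod_j min(1, 2 / (t_j |y_j|)) dy
   ([avg_sup_le]), and the theorem reduces to the inequality
      Phi_{p',q}(U) <= C Phi_{p,q}(repeated rearrangement of |f|)
   ([mixed_norm_decay_transform]).

   On the line, U is bounded by values of the rearrangement on a dyadic
   grid: the kernel is at most 4 / 2^j on the shells of radius 2^j / t, and the
   integral of g over a set of measure m is at most the sum over i of
   2 (m / 2^i) times the rearrangement of g at m / 2^i.  Hence
      U(t) <= sum_{j,i} (16 / (2^i t)) (rearrangement of g at 2^(j+1-i) / t)
   ([integral_decay_le_rearrange1]).  This is used in the first variable, and
   the kernel in the remaining variables is then integrated against a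
   rearranged function of one variable less, for every fixed value of the
   rearranged variable.  So induction on the dimension produces the repeated
   rearrangement, in the order of its definition, and only the slices of the
   partly rearranged functions have to be measurable.  With
   psi(s) = prod_j s_j^(1/p_j) phi(s), where phi is the repeated
   rearrangement, the outcome is
      prod_j t_j^(1/p'_j) U(t) <= B sup_k a_k psi(lambda_k / t)
   over a countable family of dyadic vectors lambda_k, quotients being taken
   coordinatewise ([integral_mdecay_le_sup]).  The weights a_k decay
   geometrically in every index because 1 < p_j < oo.

   It remains to take mixed norms.  No triangle inequality is available for
   small q_j, but none is needed: the q-th power of a supremum is at most the
   sum of the q-th powers, so that in each variable the norm of
   sup_k a_k psi_k is at most a constant times
   sup_k a_k^(1/2) (norm of psi_k), the other factor a_k^(1/2) serving to sum
   the series ([Lq_haar_sup], [mixed_norm_sup]).  Finally each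
   psi(lambda_k / t) has mixed norm at most a constant times that of psi,
   uniformly in k, because the norms for dt/t are invariant, up to constants, under
   t |-> lambda / t on functions which vary slowly
   ([mixed_norm_tdiv_le]); psi does, as a product of powers and of a function
   which is nonincreasing in each variable.

   A function f which is only Lebesgue measurable is handled by defining U as a
   supremum over the Borel functions between 0 and |f|: the integral of a
   nonnegative function is a supremum over Borel functions below it, and the
   repeated rearrangement is monotone. *)

(** * The integral of a nonnegative function as a lower integral *)

Import HBNNSimple.

Section lower_integral.
Local Open Scope ereal_scope.
Context d (T : measurableType d) (R : realType).
Variable mu : {measure set T -> \bar R}.
Implicit Types (F G : T -> \bar R) (D : set T).

(** The integral of a nonnegative function is by definition a supremum over the
   simple functions below it, hence monotone without any measurability.  The
   suprema and norms below are compared in this way. *)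
Lemma ge0_le_integralT F G : (forall x, 0 <= F x) -> (forall x, F x <= G x) ->
  \int[mu]_x F x <= \int[mu]_x G x.
Proof.
move=> F0 FG; rewrite !ge0_integralTE//; last by move=> x; exact: le_trans (FG x).
apply: le_ereal_sup => _ [h /= hF <-]; exists h => // x.
exact: le_trans (hF x) (FG x).
Qed.

Lemma ge0_le_integral_dom D F G :
  (forall x, D x -> 0 <= F x) -> (forall x, D x -> F x <= G x) ->
  \int[mu]_(x in D) F x <= \int[mu]_(x in D) G x.
Proof.
move=> F0 FG; rewrite integral_mkcond [leRHS]integral_mkcond.
apply: ge0_le_integralT => x; rewrite /patch; case: ifPn => //; rewrite inE => Dx.
  exact: F0.
exact: FG.
Qed.

(** To bound the integral of an arbitrary nonnegative function it suffices to
   bound the integrals of the Borel functions below it. *)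
Lemma ge0_integral_le F X : (forall x, 0 <= F x) ->
  (forall h : T -> R, measurable_fun setT h -> (forall x, (0 <= h x)%R) ->
     (forall x, (h x)%:E <= F x) -> \int[mu]_x (h x)%:E <= X) ->
  \int[mu]_x F x <= X.
Proof.
move=> F0 hX; rewrite ge0_integralTE//; apply: ge_ereal_sup => _ [h /= hF <-].
by rewrite -integralT_nnsfun; apply: hX => //; exact: measurable_funP.
Qed.

End lower_integral.

(** * Rearrangements *)

Section rearrange1_theory.
Local Open Scope ereal_scope.
Context (R : realType).
Implicit Types (g h : R -> \bar R) (s t : R).
Notation mu := (@lebesgue_measure R).

Lemma le_lebesgue_measure (A B : set R) : A `<=` B -> mu A <= mu B.
Proof.
move=> AB; rewrite /lebesgue_measure /lebesgue_stieltjes_measure.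
by rewrite /measure_extension; exact: le_mu_ext.
Qed.

(** A negative level is exceeded everywhere, that is on a set of infinite
   measure. *)
Lemma rearrange1_ge0 g t : 0 <= rearrange1 g t.
Proof.
apply: le_ereal_inf_tmp => _ [s /= st <-]; rewrite lee_fin leNgt.
apply/negP => s0; have : mu setT <= t%:E.
  apply: le_trans st; apply: le_lebesgue_measure => x _ /=.
  by rewrite (@lt_le_trans _ _ 0)// ?lte_fin.
have -> : mu setT = +oo by rewrite -set_itvNyy lebesgue_measure_itv.
by rewrite leye_eq.
Qed.

Lemma le_rearrange1 g h t : (forall x, `|g x| <= `|h x|) ->
  rearrange1 g t <= rearrange1 h t.
Proof.
move=> gh; apply: ereal_inf_le_tmp => _ [s /= st <-]; exists s => //=.
apply: le_trans st; apply: le_lebesgue_measure => x /= /lt_le_trans; exact.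
Qed.

Lemma rearrange1_anti g s t : (s <= t)%R -> rearrange1 g t <= rearrange1 g s.
Proof.
move=> st; apply: ereal_inf_le_tmp => _ [r /= rs <-]; exists r => //=.
by rewrite (le_trans rs)// lee_fin.
Qed.

Lemma measurable_gt_abs g c : measurable_fun setT g ->
  measurable [set x | c < `|g x|].
Proof.
move=> mg; rewrite -[X in measurable X]setTI.
by apply: emeasurable_fun_o_infty => //; exact: measurableT_comp.
Qed.

(** The infimum defining the rearrangement is attained, because the
   distribution function is continuous from the right. *)
Lemma measure_gt_rearrange1 g t : measurable_fun setT g -> (0 <= t)%R ->
  mu [set x | rearrange1 g t < `|g x|] <= t%:E.
Proof.
move=> mg t0; have := rearrange1_ge0 g t.
case rE : (rearrange1 g t) => [r| |] // r0; last first.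
  rewrite [X in mu X](_ : _ = set0) ?measure0 ?lee_fin//.
  by rewrite predeqE => x; split => //=; rewrite ltNge leey.
pose A n := [set x | (r + n.+1%:R^-1)%:E < `|g x|].
have mA n : measurable (A n) by exact: measurable_gt_abs.
have UA : [set x | r%:E < `|g x|] = \bigcup_n A n.
  rewrite predeqE => x; split => /=; last first.
    move=> [n _]; apply: le_lt_trans; rewrite lee_fin lerDl.
    by rewrite invr_ge0 ler0n.
  case gE : (`|g x|) => [y| |] rg.
  - rewrite lte_fin in rg.
    exists (Num.truncn (y - r)^-1) => //=; rewrite /A/= gE lte_fin -ltrBrDl.
    rewrite -[ltRHS]invrK ltf_pV2 ?posrE ?invr_gt0 ?subr_gt0 ?ltr0n//.
    by rewrite truncnS_gt.
  - by exists 0%N => //=; rewrite /A/= gE ltry.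
  - by have := abse_ge0 (g x); rewrite gE.
rewrite UA; have : mu \o A @ \oo --> mu (\bigcup_n A n).
  apply: nondecreasing_cvg_mu => //; first exact: bigcupT_measurable.
  move=> m n mn; apply/subsetPset => x; rewrite /A/=; apply: le_lt_trans.
  by rewrite lee_fin lerD2l lef_pV2 ?posrE ?ltr0n// ler_nat.
apply: cvge_le; apply: nearW => n /=.
have : rearrange1 g t < (r + n.+1%:R^-1)%:E.
  by rewrite rE lte_fin ltrDl invr_gt0 ltr0n.
move=> /ereal_inf_lt[_ [s /= st <-] sr].
apply: le_trans st; apply: le_lebesgue_measure => x; rewrite /A/=.
exact/lt_trans.
Qed.

(** Galois connection between the rearrangement and the distribution function,
   which turns superlevel sets of rearrangements into superlevel sets of
   measures of sections. *)
Lemma rearrange1_le g s t : measurable_fun setT g -> (0 <= t)%R ->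
  (rearrange1 g t <= s%:E) = (mu [set x | s%:E < `|g x|] <= t%:E).
Proof.
move=> mg t0; apply/idP/idP => [gs|st]; last by apply: ereal_inf_lbound; exists s.
apply: le_trans (measure_gt_rearrange1 mg t0).
by apply: le_lebesgue_measure => x /=; exact: le_lt_trans.
Qed.

End rearrange1_theory.

Section rearrange_theory.
Local Open Scope ereal_scope.
Context (R : realType).
Notation mu := (@lebesgue_measure R).

Lemma rearrange_ge0 n (g : n.-tuple R -> \bar R) t :
  (forall x, 0 <= g x) -> 0 <= rearrange g t.
Proof.
elim: n g t => [|n IH] g t g0 /=; first exact: g0.
by apply: IH => x; exact: rearrange1_ge0.
Qed.

Lemma le_rearrange n (g h : n.-tuple R -> \bar R) t :
  (forall x, 0 <= g x) -> (forall x, g x <= h x) ->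
  rearrange g t <= rearrange h t.
Proof.
elim: n g h t => [|n IH] g h t g0 gh /=; first exact: gh.
apply: IH => x; first exact: rearrange1_ge0.
apply: le_rearrange1 => y.
by rewrite !gee0_abs//; exact: le_trans (gh _).
Qed.

(** Monotonicity in the variable rearranged last is clear; in the earlier
   ones it is inherited from the integrand by the later rearrangements. *)
Lemma rearrange_anti n (g : n.-tuple R -> \bar R) s t :
  (forall x, 0 <= g x) -> (forall j, tnth s j <= tnth t j)%R ->
  rearrange g t <= rearrange g s.
Proof.
elim: n g s t => [|n IH] g s t g0 st /=; first by rewrite (tuple0 s) (tuple0 t).
apply: (@le_trans _ _ (rearrange (fun x' =>
    rearrange1 (fun x1 => g (tcons (x1, x'))) (thead t)) [tuple of behead s])).
  apply: IH => [x|j]; first exact: rearrange1_ge0.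
  by rewrite !tnth_behead; exact: st.
apply: le_rearrange => x; first exact: rearrange1_ge0.
by apply: rearrange1_anti; exact: st.
Qed.

(** By [rearrange1_le], the superlevel sets of this function are those of the
   measure of the sections of a Borel set. *)
Lemma measurable_rearrange1 n (g : n.+1.-tuple R -> \bar R) s :
  measurable_fun setT g -> (0 <= s)%R ->
  measurable_fun setT
    (fun x' : n.-tuple R => rearrange1 (fun x1 => g (tcons (x1, x'))) s).
Proof.
move=> mg s0.
have mgt : measurable_fun setT (g \o @tcons R n).
  by apply: measurableT_comp => //; exact: measurable_tcons.
have mgx (x' : n.-tuple R) : measurable_fun setT (fun x1 : R => g (tcons (x1, x'))).
  exact: (measurableT_comp mgt (pair2_measurable x')).
apply: (measurability _ (ErealGenOInfty.measurableE R)) => /= _ [_ [r ->] <-].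
rewrite setTI; pose A := [set z : R * n.-tuple R | r%:E < `|g (tcons z)|].
rewrite (_ : _ @^-1` _ = [set x' | s%:E < mu (ysection A x')]); last first.
  apply/funext => x'; apply/propext; rewrite /= in_itv/= andbT.
  rewrite [_%:E < _]ltNge (rearrange1_le _ (mgx x') s0) -ltNge.
  rewrite (_ : ysection A x' = [set x | r%:E < `|g (tcons (x, x'))|])//.
  by apply/seteqP; split => x; rewrite /ysection /A/= inE.
rewrite -[X in measurable X]setTI; apply: emeasurable_fun_o_infty => //.
apply: measurable_fun_ysection; rewrite -[X in measurable X]setTI.
by apply: emeasurable_fun_o_infty => //; exact: measurableT_comp.
Qed.

End rearrange_theory.

(** * A decaying kernel against a rearrangement on the line *)

Section nneseries_extra.
Local Open Scope ereal_scope.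
Context (R : realType).
Implicit Types (u v : nat -> \bar R).

Lemma nneseries_ge_term u i : (forall k, 0 <= u k) -> u i <= \sum_(k <oo) u k.
Proof.
move=> u0; apply: le_trans (nneseries_lim_ge i.+1 _); last by move=> *; exact: u0.
rewrite big_mkord big_ord_recr/= leeDr//.
by apply: sume_ge0 => *; exact: u0.
Qed.

Lemma nneseries_geometric (z : R) : (0 <= z)%R -> (z < 1)%R ->
  \sum_(k <oo) (z ^+ k)%:E = (1 - z)^-1%:E.
Proof.
move=> z0 z1; apply/cvg_lim => //.
have := @cvg_geometric_series R 1%R z; rewrite ger0_norm// mul1r => /(_ z1) zc.
apply: cvg_EFin; first by apply: nearW => n; rewrite sumEFin.
apply: cvg_trans zc; rewrite (_ : _ \o _ = series (geometric 1 z))//.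
by apply/funext => n /=; rewrite sumEFin/= /series/=; under [RHS]eq_bigr do rewrite mul1r.
Qed.

End nneseries_extra.

Section layer.
Local Open Scope ereal_scope.
Context (R : realType).
Notation mu := (@lebesgue_measure R).

Lemma half_power_small (m e : R) : (0 <= m)%R -> (0 < e)%R ->
  exists i, (m * 2^-1 ^+ i < e)%R.
Proof.
move=> m0 e0; exists (Num.truncn (m / e)).
rewrite exprVn ltr_pdivrMr ?exprn_gt0//.
have := truncnS_gt (m / e); rewrite ltr_pdivrMr// => /lt_le_trans; apply.
rewrite mulrC ler_wpM2l ?(ltW e0)// -natrX ler_nat.
exact: ltn_expl.
Qed.

(** E is cut along the levels that the rearrangement takes at m, m/2, m/4 and so
   on: the part of E above the level at m / 2^i has measure at most m / 2^i,
   and what is above all the levels is negligible. *)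
Lemma integral_set_le_rearrange1 (g : R -> \bar R) (E : set R) (m : R) :
  measurable_fun setT g -> (forall x, 0 <= g x) -> measurable E ->
  (0 < m)%R -> mu E <= m%:E ->
  \int[mu]_(x in E) g x <=
  \sum_(i <oo) (2 * m * 2^-1 ^+ i)%:E * rearrange1 g (m * 2^-1 ^+ i)%R.
Proof.
move=> mg g0 mE m0 Em.
pose s i : R := (m * 2^-1 ^+ i)%R.
have s0 i : (0 <= s i)%R by rewrite mulr_ge0 ?ltW// exprn_gt0.
pose r i := rearrange1 g (s i).
have r0 i : 0 <= r i by exact: rearrange1_ge0.
pose L i := [set x | r i < `|g x|].
have mL i : measurable (L i) by exact: measurable_gt_abs.
have muL i : mu (L i) <= (s i)%:E by exact: measure_gt_rearrange1.
(* A 0 is the whole line, so that the part of E below the first level is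
covered by the term of index 0. *)
pose A i := if i is j.+1 then L j else setT.
have mA i : measurable (A i) by case: i => //=.
have muA i : mu (E `&` A i) <= (2 * s i)%:E.
  case: i => [|i].
    rewrite setIT (le_trans Em)// lee_fin /s expr0 mulr1. lra.
  apply: le_trans (_ : mu (L i) <= _).
    by apply: le_lebesgue_measure; exact: subIsetr.
  rewrite (le_trans (muL i))// lee_fin /s exprS.
  by have := s0 i; rewrite /s; lra.
(* The points above all the levels. *)
pose N := \bigcap_i L i.
have mN : measurable N by exact: bigcap_measurable.
have N0 : mu N = 0.
  apply/eqP; rewrite eq_le measure_ge0 andbT; apply/lee_addgt0Pr => e e0.
  rewrite add0e; have [i ie] := half_power_small (ltW m0) e0.
  apply: le_trans (_ : mu (L i) <= _).
    by apply: le_lebesgue_measure => x; apply.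
  by rewrite (le_trans (muL i))// lee_fin ltW.
have mp i : measurable_fun E ((cst (r i)) \_ (A i)).
  apply: measurable_funTS.
  by apply/(measurable_restrictT _ (mA i)); exact: measurable_cst.
pose U x := \sum_(i <oo) ((cst (r i)) \_ (A i)) x.
have p0 i x : 0 <= ((cst (r i)) \_ (A i)) x by apply: erestrict_ge0 => y _; exact: r0.
apply: (@le_trans _ _ (\int[mu]_(x in E) U x)).
  apply: ae_ge0_le_integral => //.
  - exact: (measurable_funTS mg).
  - by move=> x _; apply: nneseries_ge0 => *; exact: p0.
  - have := @ge0_emeasurable_sum _ _ _ E (fun i => (cst (r i)) \_ (A i)) xpredT.
    rewrite /U; apply => //.
  exists N; split => // x /= /not_implyP[Ex /negP]; rewrite -ltNge => Ugx i _.
  rewrite /L/= gee0_abs// ltNge; apply/negP => gr.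
  move: Ugx; apply/negP; rewrite -leNgt.
  have ex : exists i, g x <= r i by exists i.
  (* The first level above g x: x is then above the preceding one. *)
  case: (ex_minnP ex) => k gk kmin.
  have Akx : A k x.
    case: k gk kmin => // k gk kmin; rewrite /A /L/= gee0_abs// ltNge.
    by apply/negP => /kmin; rewrite ltnn.
  apply: (le_trans gk); have -> : r k = ((cst (r k)) \_ (A k)) x.
    by rewrite patchE mem_set.
  exact: (nneseries_ge_term k (fun i => p0 i x)).
rewrite integral_nneseries//.
apply: lee_nneseries => [*|i _]; first exact: integral_ge0.
rewrite -integral_mkcondr integral_cst; last exact: (measurableI _ _ mE (mA i)).
rewrite muleC lee_wpmul2r//.
by have := muA i; rewrite /s mulrA.
Qed.

End layer.

Section kernel.
Context (R : realType).
Implicit Types (s t x : R).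

(** The function min(1, 2 / (t |x|)), written as an inverse so that its value at
   x = 0 is 1 in spite of the convention on division by zero. *)
Definition decay (t x : R) : R := (Num.max 1 (t * `|x| / 2))^-1.

Lemma decay_gt0 t x : (0 < decay t x).
Proof. by rewrite invr_gt0 lt_max ltr01. Qed.

Lemma decay_ge0 t x : (0 <= decay t x). Proof. exact/ltW/decay_gt0. Qed.

Lemma decay_le1 t x : (decay t x <= 1).
Proof. by rewrite invf_le1 ?le_max ?lexx// lt_max ltr01. Qed.

Lemma decay_anti s t x : (s <= t) -> (decay t x <= decay s x).
Proof.
move=> st; rewrite lef_pV2 ?posrE ?lt_max ?ltr01// ge_max !le_max lexx/=.
by apply/orP; right; rewrite ler_wpM2r// ler_wpM2r.
Qed.

Lemma continuous_decayV t : continuous (fun x => (decay t x)^-1).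
Proof.
move=> x; rewrite (_ : (fun _ => _) = (fun x => Num.max 1 (t * `|x| / 2))); last first.
  by apply/funext => y; rewrite /decay invrK.
apply: (@continuous_max _ _ (cst 1) (fun x => t * `|x| / 2)).
  exact: cvg_cst.
by apply: cvgMl; apply: cvgMr; apply: cvg_norm; exact: cvg_id.
Qed.

Lemma measurable_decay t : measurable_fun setT (decay t).
Proof.
apply: continuous_measurable_fun => x.
rewrite (_ : decay t = (fun x => ((decay t x)^-1)^-1)).
  by apply: cvgV; [rewrite invr_neq0// gt_eqF// decay_gt0|exact: continuous_decayV].
by apply/funext => y; rewrite invrK.
Qed.

Lemma decay_shell t x : (0 < t) ->
  exists j, (`|x| <= 2 ^+ j / t) /\ (decay t x <= 4 * 2^-1 ^+ j).
Proof.
move=> t0.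
have ex : exists j, (`|x| <= 2 ^+ j / t).
  exists (Num.truncn (`|x| * t)); rewrite ler_pdivlMr//.
  apply: (le_trans (ltW (truncnS_gt _))).
  by rewrite -natrX ler_nat; exact: ltn_expl.
case: (ex_minnP ex) => j xj jmin; exists j; split => //.
case: j xj jmin => [|j] xj jmin.
  by rewrite expr0 mulr1 (le_trans (decay_le1 _ _))// ler1n.
have : ~~ (`|x| <= 2 ^+ j / t) by apply/negP => /jmin; rewrite ltnn.
rewrite -ltNge ltr_pdivrMr// => xt.
rewrite exprVn exprS /decay.
rewrite (_ : 4 * (2 * 2 ^+ j)^-1 = (2 ^+ j / 2)^-1); last first.
  by field; rewrite expf_neq0.
rewrite lef_pV2 ?posrE ?divr_gt0 ?exprn_gt0 ?lt_max ?ltr01//.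
by rewrite le_max; apply/orP; right; rewrite ler_pM2r// mulrC ltW.
Qed.

End kernel.

Section layer2.
Local Open Scope ereal_scope.
Context (R : realType).
Notation mu := (@lebesgue_measure R).

(** The shell of radius 2^j / t has measure 2^(j+1) / t, and
   [integral_set_le_rearrange1] applies to it. *)
Lemma integral_decay_le_rearrange1 (g : R -> \bar R) (t : R) :
  measurable_fun setT g -> (forall x, 0 <= g x) -> (0 < t)%R ->
  \int[mu]_x (g x * (decay t x)%:E) <=
  \sum_(j <oo) \sum_(i <oo)
    (16 * 2^-1 ^+ i / t)%:E * rearrange1 g (2 ^+ j.+1 * 2^-1 ^+ i / t)%R.
Proof.
move=> mg g0 t0.
pose B j : set R := `[(- (2 ^+ j / t))%R, (2 ^+ j / t)%R]%classic.
have BP j x : B j x <-> (`|x| <= 2 ^+ j / t)%R.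
  by rewrite /B/= in_itv/= ler_norml.
have mB j : measurable (B j) by exact: measurable_itv.
have m0 j : (0 < 2 ^+ j.+1 / t)%R by rewrite divr_gt0// exprn_gt0.
have muB j : mu (B j) <= (2 ^+ j.+1 / t)%:E.
  rewrite /B lebesgue_measure_itv/=; case: ifP => _; last by rewrite lee_fin ltW.
  by rewrite -EFinB lee_fin exprS; lra.
pose c j : R := (4 * 2^-1 ^+ j)%R.
have c0 j : (0 <= c j)%R by rewrite mulr_ge0// exprn_ge0// invr_ge0.
have mgB j : measurable_fun setT (g \_ (B j)).
  by apply/(measurable_restrictT _ (mB j)); exact: (measurable_funTS mg).
have gB0 j x : 0 <= (g \_ (B j)) x by apply: erestrict_ge0 => y _; exact: g0.
pose U x := \sum_(j <oo) (c j)%:E * (g \_ (B j)) x.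
have cg0 j x : 0 <= (c j)%:E * (g \_ (B j)) x by rewrite mule_ge0// lee_fin.
apply: (@le_trans _ _ (\int[mu]_x U x)).
  apply: ge0_le_integralT => x; first by rewrite mule_ge0// lee_fin decay_ge0.
  have [j [xj kj]] := decay_shell x t0.
  apply: le_trans (nneseries_ge_term j (fun j => cg0 j x)).
  rewrite patchE mem_set; last exact/BP.
  by rewrite muleC lee_wpmul2r// lee_fin.
rewrite /U integral_nneseries//; last first.
  by move=> j; exact: (measurable_funeM _ (mgB j)).
apply: lee_nneseries => [j _ _|j _]; first exact: integral_ge0.
rewrite ge0_integralZl_EFin//; last exact: mgB.
rewrite (_ : \int[mu]_x _ = \int[mu]_(x in B j) g x); last by rewrite [RHS]integral_mkcond.
apply: (@le_trans _ _ ((c j)%:E * \sum_(i <oo)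
  (2 * (2 ^+ j.+1 / t) * 2^-1 ^+ i)%:E *
   rearrange1 g ((2 ^+ j.+1 / t) * 2^-1 ^+ i)%R)).
  rewrite lee_wpmul2l ?lee_fin//.
  exact: (integral_set_le_rearrange1 mg g0 (mB j) (m0 j) (muB j)).
rewrite -nneseriesZl; last first.
  move=> i _; rewrite mule_ge0 ?rearrange1_ge0// lee_fin.
  by rewrite !mulr_ge0 ?exprn_ge0 ?invr_ge0// ltW.
apply: lee_nneseries => [i _ _|i _].
  rewrite !mule_ge0 ?rearrange1_ge0// lee_fin//.
  by rewrite !mulr_ge0 ?exprn_ge0 ?invr_ge0// ltW.
rewrite muleA -EFinM (mulrAC (2 ^+ j.+1)%R) lee_wpmul2r ?rearrange1_ge0//.
rewrite lee_fin le_eqVlt; apply/orP; left; apply/eqP; rewrite /c exprS exprVn.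
by field; rewrite gt_eqF//= expf_neq0.
Qed.

End layer2.

(** * Sums over countable types and summable weights *)

Section countable_sum.
Local Open Scope ereal_scope.
Context (R : realType).

(** The sum of a nonnegative family over a countable type, as a series over the
   codes of its elements, so that monotone convergence applies to it; see
   [csum_esum]. *)
Definition csum (I : countType) (u : I -> \bar R) : \bar R :=
  \sum_(n <oo) oapp u 0 (pickle_inv n).

Lemma csum_esum (I : countType) (u : I -> \bar R) : (forall i, 0 <= u i) ->
  csum u = \esum_(i in setT) u i.
Proof.
move=> u0; have v0 n : 0 <= oapp u 0 (pickle_inv n) by case: pickle_inv => /=.
rewrite /csum nneseries_esumT//.
rewrite (esumID (range (@pickle I)))// setTI [X in _ + X]esum1 ?adde0.
  rewrite esum_image.
    by apply: eq_esum => i _; rewrite pickleK_inv.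
  by move=> i j _ _; exact: (pcan_inj (@pickleK I)).
move=> n [_ /= nr]; case pn : (pickle_inv n) => [i|]//=.
by exfalso; apply: nr; exists i => //; have := @pickle_invK I n; rewrite pn.
Qed.

Lemma csumZ (I : countType) (u : I -> \bar R) (c : R) : (forall i, 0 <= u i) ->
  csum (fun i => c%:E * u i) = c%:E * csum u.
Proof.
move=> u0; rewrite /csum -nneseriesZl; last by move=> n _; case: pickle_inv => /=.
by apply: eq_eseriesr => n _; case: pickle_inv => //=; rewrite mule0.
Qed.

Lemma csum_ge0 (I : countType) (u : I -> \bar R) : (forall i, 0 <= u i) ->
  0 <= csum u.
Proof. by move=> u0; apply: nneseries_ge0 => n _ _; case: pickle_inv => /=. Qed.

Lemma le_csum (I : countType) (u v : I -> \bar R) : (forall i, 0 <= u i) ->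
  (forall i, u i <= v i) -> csum u <= csum v.
Proof.
by move=> u0 uv; apply: lee_nneseries => [n _ _|n _]; case: pickle_inv => /=.
Qed.

Lemma csum_ge_term (I : countType) (u : I -> \bar R) i : (forall i, 0 <= u i) ->
  u i <= csum u.
Proof.
move=> u0; have := @nneseries_ge_term _ (fun n => oapp u 0 (pickle_inv n)) (pickle i).
by rewrite pickleK_inv; apply => n; case: pickle_inv => /=.
Qed.

Lemma integral_csum d (T : measurableType d) (mu : {measure set T -> \bar R})
    (D : set T) (I : countType) (u : I -> T -> \bar R) :
  measurable D -> (forall i, measurable_fun D (u i)) ->
  (forall i x, D x -> 0 <= u i x) ->
  \int[mu]_(x in D) csum (u ^~ x) = csum (fun i => \int[mu]_(x in D) u i x).
Proof.
move=> mD mu_ u0; rewrite /csum.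
under eq_integral do under eq_eseriesr do idtac.
rewrite integral_nneseries//.
- apply: eq_eseriesr => n _; case: pickle_inv => //=; exact: integral0.
- by move=> n; case: pickle_inv => //=.
- by move=> n x Dx; case: pickle_inv => [i|]//=; exact: u0.
Qed.

(** All powers are summable, however small the exponent, so that the square
   roots of weights are again weights: an argument in n variables takes n
   square roots and sums a power of the weights after each of them. *)
Definition weights (I : countType) (a : I -> R) :=
  (forall i, 0 < a i <= 1)%R /\
  forall r, (0 < r)%R -> csum (fun i => (a i `^ r)%:E) < +oo.

Lemma weights_sqrt (I : countType) (a : I -> R) : weights a ->
  weights (fun i => (a i `^ 2^-1)%R).
Proof.
move=> [a01 ar]; split => [i|r r0].
  have /andP[a0 a1] := a01 i; rewrite powR_gt0//=.
  have := @ge0_ler_powR _ 2^-1%R _ _ _ _ _ a1.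
  by rewrite powR1; apply; rewrite ?invr_ge0// nnegrE// ltW.
under [X in csum X]funext do rewrite -powRrM.
by apply: ar; rewrite mulr_gt0.
Qed.

Lemma weights_geometric (z : R) : (0 < z < 1)%R -> weights (fun k : nat => z ^+ k)%R.
Proof.
move=> /andP[z0 z1]; split => [i|r r0].
  by rewrite exprn_gt0//= exprn_ile1// ltW.
have zr0 : (0 < z `^ r)%R by exact: powR_gt0.
have zr1 : (z `^ r < 1)%R.
  have := @gt0_ltr_powR _ r r0 _ _ _ _ z1.
  by rewrite powR1; apply; rewrite nnegrE// ltW.
rewrite csum_esum//; last by move=> i; rewrite lee_fin powR_ge0.
rewrite -nneseries_esumT; last by move=> i; rewrite lee_fin powR_ge0.
rewrite (eq_eseriesr (g := fun k => ((z `^ r) ^+ k)%:E)).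
  by rewrite nneseries_geometric ?ltry// ltW.
by move=> k _; rewrite -!powR_mulrn ?powR_ge0 ?ltW// -!powRrM mulrC.
Qed.

Lemma weights_unit : weights (fun _ : unit => 1%R : R).
Proof.
split => [_|r r0]; first by rewrite ltr01 lexx.
rewrite csum_esum => [|_]; last by rewrite lee_fin powR_ge0.
rewrite (_ : setT = [set tt]); last by apply/seteqP; split => -[].
by rewrite esum_set1 ?ltry// lee_fin powR_ge0.
Qed.

Lemma weights_prod (I J : countType) (a : I -> R) (b : J -> R) :
  weights a -> weights b ->
  weights (fun k : I * J => a k.1 * b k.2)%R.
Proof.
move=> [a01 ar] [b01 br]; split => [[i j]|r r0] /=.
  have /andP[a0 a1] := a01 i; have /andP[b0 b1] := b01 j.
  by rewrite mulr_gt0//= mulr_ile1// ltW.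
have ge0 (k : I * J) : 0 <= ((a k.1 * b k.2) `^ r)%:E by rewrite lee_fin powR_ge0.
have a0 i : (0 <= a i)%R by have /andP[/ltW] := a01 i.
have b0 j : (0 <= b j)%R by have /andP[/ltW] := b01 j.
rewrite csum_esum//.
rewrite (_ : setT = [set: I] `*`` (fun=> [set: J])); last by apply/seteqP; split.
rewrite -(@esum_esum _ _ _ _ _ (fun i j => ((a i * b j) `^ r)%:E)); last first.
  by move=> i j _ _; rewrite lee_fin powR_ge0.
have bE : csum (fun j => (b j `^ r)%:E) \is a fin_num.
  by rewrite ge0_fin_numE ?br// csum_ge0// => j; rewrite lee_fin powR_ge0.
rewrite (eq_esum (b := fun i => (fine (csum (fun j => (b j `^ r)%:E)))%:E * (a i `^ r)%:E)).
  rewrite -csum_esum; last first.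
    move=> i; rewrite fineK// mule_ge0 ?csum_ge0 ?lee_fin ?powR_ge0// => j.
    by rewrite lee_fin powR_ge0.
  rewrite csumZ; last by move=> i; rewrite lee_fin powR_ge0.
  rewrite fineK// lte_mul_pinfty ?ar// csum_ge0// => j.
  by rewrite lee_fin powR_ge0.
move=> i _; rewrite fineK// muleC -csumZ; last by move=> j; rewrite lee_fin powR_ge0.
rewrite csum_esum; last by move=> j; rewrite -EFinM lee_fin mulr_ge0// powR_ge0.
by apply: eq_esum => j _; rewrite -EFinM powRM.
Qed.

End countable_sum.

(** * The quasi-norms of the multiplicative half-line *)

Section ereal_extra.
Local Open Scope ereal_scope.
Context (R : realType).

(** Homogeneity holds without measurability, since multiplication by c is a
   bijection of the functions below F with those below c F. *)
Lemma ge0_integralZ_lower d (T : measurableType d)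
    (mu : {measure set T -> \bar R}) (D : set T) (F : T -> \bar R) (c : R) :
  measurable D -> (0 < c)%R -> (forall x, D x -> 0 <= F x) ->
  \int[mu]_(x in D) (c%:E * F x) = c%:E * \int[mu]_(x in D) F x.
Proof.
move=> mD.
have half (k : R) (G : T -> \bar R) : (0 < k)%R -> (forall x, 0 <= G x) ->
    \int[mu]_x (k%:E * G x) <= k%:E * \int[mu]_x G x.
  move=> k0 G0; apply: ge0_integral_le => [x|h mh h0 hG].
    by rewrite mule_ge0// lee_fin ltW//.
  rewrite (_ : \int[mu]_x (h x)%:E = k%:E * \int[mu]_x (k^-1 * h x)%:E).
    rewrite lee_wpmul2l ?lee_fin ?(ltW k0)//; apply: ge0_le_integralT => x.
      by rewrite lee_fin mulr_ge0 ?invr_ge0 ?(ltW k0).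
    by rewrite EFinM lee_pdivrMl.
  rewrite -ge0_integralZl_EFin ?(ltW k0)//; last 2 first.
  - by move=> x _; rewrite lee_fin mulr_ge0 ?invr_ge0 ?(ltW k0).
  - by apply/measurable_EFinP; apply: measurable_funM => //; exact: measurable_cst.
  by apply: eq_integral => x _; rewrite -EFinM mulrA divff ?mul1r// gt_eqF.
move=> c0 F0; rewrite integral_mkcond [in RHS]integral_mkcond.
have E0 x : 0 <= (F \_ D) x by exact: erestrict_ge0.
rewrite (_ : _ \_ D = fun x => c%:E * (F \_ D) x); last first.
  by apply/funext => x; rewrite /patch; case: ifP => // _; rewrite mule0.
apply/eqP; rewrite eq_le half//=.
rewrite -(@lee_pmul2l _ c^-1%:E) ?lte_fin ?invr_gt0// muleA -EFinM mulVf ?gt_eqF//.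
rewrite mul1e; apply: le_trans (half _ _ _ _); rewrite ?invr_gt0//; last first.
  by move=> x; rewrite mule_ge0// lee_fin ltW.
apply: ge0_le_integralT => // x.
by rewrite muleA -EFinM mulVf ?gt_eqF// mul1e.
Qed.

Lemma poweR_ge0_le (x y : \bar R) r : (0 < r)%R -> 0 <= x -> x <= y ->
  x `^ r <= y `^ r.
Proof.
move=> r0 x0 xy; apply: gt0_ler_poweR => //; rewrite ?ltW//.
- by rewrite in_itv/= x0 leey.
- by rewrite in_itv/= (le_trans x0 xy) leey.
Qed.

Lemma poweRK (x : \bar R) r : (0 < r)%R -> 0 <= x -> (x `^ r) `^ r^-1 = x.
Proof. by move=> r0 x0; rewrite -poweRrM divff ?gt_eqF// poweRe1. Qed.

Lemma poweRVK (x : \bar R) r : (0 < r)%R -> 0 <= x -> (x `^ r^-1) `^ r = x.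
Proof. by move=> r0 x0; rewrite -poweRrM mulVf ?gt_eqF// poweRe1. Qed.

End ereal_extra.

Section Lq_haar_theory.
Local Open Scope ereal_scope.
Context (R : realType).
Notation mu := (@lebesgue_measure R).
Implicit Types (q : \bar R) (G H : R -> \bar R).
Local Notation D := (`]0%R, +oo[%classic : set R).

Lemma gt0_halfline (t : R) : D t <-> (0 < t)%R.
Proof. by rewrite /= in_itv/= andbT. Qed.

Lemma Lq_haar_ge0 q G : (forall t, (0 < t)%R -> 0 <= G t) -> 0 <= Lq_haar q G.
Proof.
move=> G0; case: q => [r| |] //=; first exact: poweR_ge0.
by apply: le_trans (G0 1%R ltr01) _; apply: ereal_sup_ubound; exists 1%R => //=.
Qed.

Lemma le_Lq_haar q G H : 0 < q -> (forall t, (0 < t)%R -> 0 <= G t) ->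
  (forall t, (0 < t)%R -> G t <= H t) -> Lq_haar q G <= Lq_haar q H.
Proof.
case: q => [r| |] //= q0 G0 GH.
  rewrite lte_fin in q0.
  apply: poweR_ge0_le; rewrite ?invr_gt0//.
    by apply: integral_ge0 => t /gt0_halfline t0; rewrite mule_ge0 ?poweR_ge0// lee_fin invr_ge0 ltW.
  apply: ge0_le_integral_dom => t /gt0_halfline t0.
    by rewrite mule_ge0 ?poweR_ge0// lee_fin invr_ge0 ltW.
  rewrite lee_wpmul2r ?lee_fin ?invr_ge0 ?(ltW t0)//.
  by apply: poweR_ge0_le; [|exact: G0|exact: GH].
apply: ge_ereal_sup => _ [t /= t0 <-]; apply: (le_trans (GH _ t0)).
by apply: ereal_sup_ubound; exists t.
Qed.

Lemma eq_Lq_haar q G H : 0 < q -> (forall t, (0 < t)%R -> 0 <= G t) ->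
  (forall t, (0 < t)%R -> G t = H t) -> Lq_haar q G = Lq_haar q H.
Proof.
move=> q0 G0 GH; apply/eqP; rewrite eq_le !le_Lq_haar// => t t0; rewrite ?GH//.
by rewrite -GH// G0.
Qed.

Lemma Lq_haarZ q G (c : R) : 0 < q -> (0 < c)%R ->
  (forall t, (0 < t)%R -> 0 <= G t) ->
  Lq_haar q (fun t => c%:E * G t) = c%:E * Lq_haar q G.
Proof.
case: q => [r| |] // q0 c0 G0; rewrite /Lq_haar.
  rewrite lte_fin in q0.
  have F0 t : D t -> 0 <= G t `^ r * (t^-1)%:E.
    by move=> /gt0_halfline t0; rewrite mule_ge0 ?poweR_ge0// lee_fin invr_ge0 ltW.
  rewrite [X in X `^ _ = _](_ : _ =
      \int[mu]_(t in D) ((c `^ r)%:E * (G t `^ r * (t^-1)%:E))); last first.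
    apply: eq_integral => t; rewrite inE => /gt0_halfline t0.
    by rewrite poweRM ?G0 ?lee_fin ?(ltW c0)// muleA -poweR_EFin.
  rewrite ge0_integralZ_lower ?powR_gt0// poweRM ?lee_fin ?powR_ge0//; last first.
    exact: integral_ge0.
  by rewrite -poweR_EFin poweRK// lee_fin ltW.
apply/eqP; rewrite eq_le; apply/andP; split.
  apply: ge_ereal_sup => _ [t /= t0 <-]; rewrite lee_wpmul2l ?lee_fin ?(ltW c0)//.
  by apply: ereal_sup_ubound; exists t.
rewrite -lee_pdivlMl//; apply: ge_ereal_sup => _ [t /= t0 <-].
rewrite lee_pdivlMl//.
by apply: ereal_sup_ubound; exists t.
Qed.

(** For finite q, the q-th power of a supremum is at most the sum of the q-th
   powers, which can be integrated termwise.  Half of each weight makes the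
   series converge, the other half stays in front of the norm. *)
Lemma Lq_haar_sup q (I : countType) (i0 : I) (a : I -> R) : 0 < q -> weights a ->
  exists2 C : R, (0 < C)%R & forall (G : I -> R -> \bar R) H,
    (forall i, measurable_fun D (G i)) ->
    (forall i t, (0 < t)%R -> 0 <= G i t) -> (forall t, (0 < t)%R -> 0 <= H t) ->
    (forall t, (0 < t)%R -> H t <= ereal_sup (range (fun i => (a i)%:E * G i t))) ->
    Lq_haar q H <=
      C%:E * ereal_sup (range (fun i => (a i `^ 2^-1)%:E * Lq_haar q (G i))).
Proof.
move=> q0 wa; have [a01 _] := wa; have [b01 bs] := weights_sqrt wa.
have a0 i : (0 < a i)%R by have /andP[] := a01 i.
pose b i := (a i `^ 2^-1)%R.
have b0 i : (0 < b i)%R by exact: powR_gt0.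
have bb i : (b i * b i = a i)%R.
  by rewrite /b -powRD ?gt_eqF ?implybT// (_ : 2^-1 + 2^-1 = 1)%R ?powRr1 ?ltW//; field.
case: q q0 => [r| |]// q0; last first.
  exists 1%R => // G H mG G0 H0 HG; rewrite mul1e /=.
  apply: ge_ereal_sup => _ [t /= t0 <-]; apply: (le_trans (HG t t0)).
  apply: ge_ereal_sup => _ [i _ <-].
  apply: (@le_trans _ _ ((b i)%:E * ereal_sup [set G i t | t in [set t : R | (0 < t)%R]])).
    apply: lee_pmul; rewrite ?lee_fin ?(ltW (a0 i))// ?G0//.
      rewrite -bb ger_pMl//; by have /andP[] := b01 i.
    by apply: ereal_sup_ubound; exists t.
  by apply: ereal_sup_ubound; exists i.
rewrite lte_fin in q0.
pose S := csum (fun i => (b i `^ r)%:E).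
have S0 : 0 <= S by apply: csum_ge0 => i; rewrite lee_fin powR_ge0.
have Sfin : S \is a fin_num by rewrite ge0_fin_numE//; exact: bs.
(* Adding 1 keeps the constant positive without a discussion of S = 0. *)
exists ((fine S + 1) `^ r^-1)%R.
  by rewrite powR_gt0// ltr_pwDr// fine_ge0.
move=> G H mG G0 H0 HG.
set X := ereal_sup _.
have NX i : (b i)%:E * Lq_haar r%:E (G i) <= X by apply: ereal_sup_ubound; exists i.
have N0 i : 0 <= Lq_haar r%:E (G i) by apply: Lq_haar_ge0; exact: G0.
have X0 : 0 <= X.
  by apply: le_trans (NX i0); rewrite mule_ge0// lee_fin ltW.
pose u i t := (a i `^ r)%:E * (G i t `^ r * (t^-1)%:E).
have u0 i t : (0 < t)%R -> 0 <= u i t.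
  move=> t0; rewrite !mule_ge0 ?lee_fin ?powR_ge0 ?poweR_ge0 ?invr_ge0 ?ltW//.
have mu_ i : measurable_fun D (u i).
  apply: measurable_funeM; apply: emeasurable_funM.
    exact: (measurableT_comp (measurable_poweR r) (mG i)).
  apply/measurable_EFinP; apply: open_continuous_measurable_fun => //.
  by move=> t; rewrite inE => /gt0_halfline t0; apply: cvgV => //; rewrite gt_eqF.
have HU t : (0 < t)%R -> H t `^ r * (t^-1)%:E <= csum (u ^~ t).
  move=> t0; rewrite -lee_pdivlMr ?invr_gt0// invrK.
  have W0 : 0 <= csum (u ^~ t) * t%:E.
    by rewrite mule_ge0 ?csum_ge0 ?lee_fin ?ltW// => i; exact: u0.
  rewrite -[leRHS](@poweRVK _ _ r)//.
  apply: poweR_ge0_le => //; first exact: H0.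
  apply: (le_trans (HG t t0)); apply: ge_ereal_sup => _ [i _ <-].
  rewrite -[leLHS](@poweRK _ _ r)//; last by rewrite mule_ge0 ?G0// lee_fin ltW.
  apply: poweR_ge0_le; rewrite ?invr_gt0 ?poweR_ge0//.
  rewrite -lee_pdivrMr// poweRM ?G0 ?lee_fin ?(ltW (a0 i))//.
  by rewrite poweR_EFin -muleA; apply: (csum_ge_term i) => k; exact: u0.
have -> : Lq_haar r%:E H = (\int[mu]_(t in D) (H t `^ r * (t^-1)%:E)) `^ r^-1 by [].
apply: (@le_trans _ _ (((fine S + 1)%:E * X `^ r) `^ r^-1)); last first.
  rewrite poweRM ?poweR_ge0 ?lee_fin ?addr_ge0 ?fine_ge0//.
  by rewrite poweRK.
apply: poweR_ge0_le; rewrite ?invr_gt0//.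
  by apply: integral_ge0 => t /gt0_halfline t0; rewrite mule_ge0 ?poweR_ge0// lee_fin invr_ge0 ltW.
apply: (@le_trans _ _ (\int[mu]_(t in D) csum (u ^~ t))).
  apply: ge0_le_integral_dom => t /gt0_halfline t0; last exact: HU.
  by rewrite mule_ge0 ?poweR_ge0// lee_fin invr_ge0 ltW.
rewrite integral_csum//; last by move=> i t /gt0_halfline; exact: u0.
have F0 i t : D t -> 0 <= G i t `^ r * (t^-1)%:E.
  by move=> /gt0_halfline t0; rewrite mule_ge0 ?poweR_ge0// lee_fin invr_ge0 ltW.
apply: (@le_trans _ _ (csum (fun i => (b i `^ r)%:E * X `^ r))).
  apply: le_csum => i; first by apply: integral_ge0 => t /gt0_halfline; exact: u0.
  rewrite ge0_integralZ_lower ?powR_gt0//; last exact: F0.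
  rewrite -bb powRM ?(ltW (b0 i))// EFinM -muleA lee_wpmul2l ?lee_fin ?powR_ge0//.
  rewrite -[X in _ * X](@poweRVK _ _ r)//; last by apply: integral_ge0; exact: F0.
  rewrite -poweR_EFin -poweRM ?lee_fin ?(ltW (b0 i))// ?poweR_ge0//.
  by apply: poweR_ge0_le => //; rewrite ?mule_ge0 ?poweR_ge0 ?lee_fin ?(ltW (b0 i))//; exact: NX.
have [Xoo|Xfin] := eqVneq X +oo.
  rewrite Xoo poweRyr ?gt_eqF// gt0_muley ?leey// lte_fin ltr_pwDr// fine_ge0//.
have Xrfin : X `^ r \is a fin_num.
  by apply: fin_num_poweR; rewrite ge0_fin_numE// ltey.
rewrite (_ : (fun i => _) = (fun i => (fine (X `^ r))%:E * (b i `^ r)%:E)); last first.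
  by apply/funext => i; rewrite fineK// muleC.
rewrite csumZ; last by move=> i; rewrite lee_fin powR_ge0.
rewrite fineK// muleC lee_wpmul2r ?poweR_ge0// -/S -{1}(fineK Sfin) lee_fin.
by rewrite lerDl.
Qed.

End Lq_haar_theory.

Section inversion.
Local Open Scope ereal_scope.
Context (R : realType).
Notation mu := (@lebesgue_measure R).
Local Notation D := (`]0%R, +oo[%classic : set R).

(** On a dyadic interval, such a function is controlled at the right end by all
   its other values. *)
Definition doubling (K : R) (G : R -> \bar R) := forall s s' : R,
  (0 < s')%R -> (s' <= s)%R -> (s <= 2 * s')%R -> G s <= K%:E * G s'.

Lemma measurable_invr : measurable_fun D (fun t : R => (t^-1)%:E).
Proof.
apply/measurable_EFinP; apply: open_continuous_measurable_fun => //.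
by move=> t; rewrite inE => /gt0_halfline t0; apply: cvgV => //; rewrite gt_eqF.
Qed.

Lemma integral_cst_itv (c : \bar R) (a b : R) : (a <= b)%R ->
  \int[mu]_x ((cst c) \_ `[a, b]) x = c * (b - a)%:E.
Proof.
move=> ab; rewrite -integral_mkcond integral_cst//.
have <- : lebesgue_measure `[a, b]%classic = (b - a)%:E; last by [].
rewrite lebesgue_measure_itv/= lte_fin; case: ifPn => //; rewrite -leNgt => ba.
by congr _%:E; apply/esym/eqP; rewrite subr_eq0 eq_le ba ab.
Qed.

(** For s = l / t, the value F s is at most 2 K times the integral of
   F(s') / s' over the interval from s / 2 to s.  After exchanging the two
   integrals, the inner one is that of 1 / t over the interval from l / (2 s')
   to l / s', which is at most 1. *)
Lemma integral_haar_inv_le (F : R -> \bar R) (K l : R) : (0 < l)%R -> (0 < K)%R ->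
  measurable_fun D F -> (forall t, (0 < t)%R -> 0 <= F t) -> doubling K F ->
  \int[mu]_(t in D) (F (l / t)%R * (t^-1)%:E) <=
  (2 * K)%:E * \int[mu]_(t in D) (F t * (t^-1)%:E).
Proof.
move=> l0 K0 mF F0 dF.
pose g : R -> \bar R := (fun t => (t^-1)%:E) \_ D.
pose F1 : R -> \bar R := (fun t => F t * (t^-1)%:E) \_ D.
have mD : measurable D by exact: measurable_itv.
have g0 t : 0 <= g t.
  by apply: erestrict_ge0 => x /gt0_halfline x0; rewrite lee_fin invr_ge0 ltW.
have F10 t : 0 <= F1 t.
  by apply: erestrict_ge0 => x /gt0_halfline x0; rewrite mule_ge0 ?F0// lee_fin invr_ge0 ltW.
have mg : measurable_fun setT g.
  by apply/(measurable_restrictT _ mD); exact: measurable_invr.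
have mF1 : measurable_fun setT F1.
  apply/(measurable_restrictT _ mD); apply: emeasurable_funM => //.
  exact: measurable_invr.
pose A : set (R * R) := [set z | l <= 2 * (z.1 * z.2)]%R `&` [set z | z.1 * z.2 <= l]%R.
have mm : measurable_fun setT (fun z : R * R => z.1 * z.2)%R.
  by apply: measurable_funM; [exact: measurable_fst|exact: measurable_snd].
have mA : measurable A.
  apply: measurableI; rewrite -[X in measurable X]setTI.
    apply: measurable_fun_le => //.
    by apply: measurable_funM => //; exact: measurable_cst.
  by apply: measurable_fun_le => //; exact: measurable_cst.
(* With z = (t, s), A is the set where l / (2 t) <= s <= l / t. *)
pose f (z : R * R) : \bar R := F1 z.2 * g z.1 * (\1_A z)%:E.
have f0 z : 0 <= f z by rewrite !mule_ge0// lee_fin.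
have mf : measurable_fun setT f.
  apply: emeasurable_funM; last by apply/measurable_EFinP; exact: measurable_indic.
  apply: emeasurable_funM.
    exact: (measurableT_comp mF1 measurable_snd).
  exact: (measurableT_comp mg measurable_fst).
apply: (@le_trans _ _ ((2 * K)%:E * \int[mu]_t \int[mu]_s f (t, s))); last first.
  rewrite lee_wpmul2l ?lee_fin ?mulr_ge0 ?(ltW K0)//.
  have -> : \int[mu]_t \int[mu]_s f (t, s) = \int[mu]_s \int[mu]_t f (t, s).
    exact: fubini_tonelli.
  rewrite [leRHS]integral_mkcond; apply: ge0_le_integralT => s.
    exact: integral_ge0.
  have [s0|s0] := ltP 0%R s; last first.
    rewrite integral0_eq// => t _; rewrite /f /F1 /= patchE memNset ?mul0e//.
    by move=> /gt0_halfline; rewrite ltNge s0.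
  have ab : (l / (2 * s) <= l / s)%R.
    rewrite ler_pM2l// lef_pV2 ?posrE ?mulr_gt0//; lra.
  apply: (@le_trans _ _ (\int[mu]_t ((cst (F1 s * (2 * s / l)%:E)) \_
      `[(l / (2 * s))%R, (l / s)%R]) t)).
    apply: ge0_le_integralT => // t; rewrite /f/=.
    have [As|/negP As] := boolP ((t, s) \in A); last first.
      rewrite indicE (negbTE (introN idP As)) mule0.
      by apply: erestrict_ge0 => y _; rewrite mule_ge0// lee_fin divr_ge0 ?mulr_ge0 ?(ltW l0) ?(ltW s0).
    rewrite indicE As mule1; move: As; rewrite inE => -[/= A1 A2].
    have t0 : (0 < t)%R.
      by rewrite -(pmulr_lgt0 _ s0); move: A1 l0; lra.
    rewrite patchE mem_set; last first.
      rewrite /= in_itv/= ler_pdivrMr ?mulr_gt0// ler_pdivlMr// A2 andbT.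
      by move: A1; lra.
    rewrite lee_wpmul2l//.
    rewrite /g patchE mem_set; last exact/gt0_halfline.
    rewrite lee_fin ler_pdivlMr// mulrC ler_pdivrMr//; lra.
  rewrite integral_cst_itv// -muleA -EFinM.
  rewrite (_ : (2 * s / l * (l / s - l / (2 * s)) = 1)%R); last first.
    by field; rewrite !gt_eqF.
  by rewrite mule1.
rewrite -ge0_integralZ_lower//; last 2 first.
- by rewrite mulr_gt0.
- by move=> t _; exact: integral_ge0.
rewrite [leLHS]integral_mkcond; apply: ge0_le_integralT => t.
  apply: erestrict_ge0 => x /gt0_halfline x0.
  by rewrite mule_ge0 ?F0 ?divr_gt0// lee_fin invr_ge0 ltW.
have [t0|t0] := ltP 0%R t; last first.
  rewrite patchE memNset; last by move=> /gt0_halfline; rewrite ltNge t0.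
  by rewrite mule_ge0 ?lee_fin ?mulr_ge0 ?(ltW K0)//; exact: integral_ge0.
rewrite patchE mem_set; last exact/gt0_halfline.
have a0 : (0 < l / t)%R by rewrite divr_gt0.
have K1 : (0 < K^-1)%R by rewrite invr_gt0.
set a := (l / t)%R in a0 *.
have ab : (a / 2 <= a)%R by lra.
rewrite -lee_pdivrMl ?mulr_gt0//.
pose c : R := (K^-1 * a^-1 * t^-1)%R.
have c0 : (0 <= c)%R by rewrite !mulr_ge0// invr_ge0 ltW.
apply: (@le_trans _ _ (\int[mu]_s ((cst (c%:E * F a)) \_ `[(a / 2)%R, a]) s)).
  rewrite integral_cst_itv// muleAC -EFinM (muleC (F a)) muleA -EFinM.
  rewrite lee_wpmul2r ?F0// lee_fin le_eqVlt; apply/orP; left; apply/eqP.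
  by rewrite /c; field; rewrite !gt_eqF.
apply: ge0_le_integralT => s.
  by apply: erestrict_ge0 => y _; rewrite mule_ge0 ?F0// lee_fin.
rewrite patchE; case: ifPn => [|_]; last exact: f0.
rewrite inE/= in_itv/= => /andP[as1 as2].
have s0 : (0 < s)%R by apply: lt_le_trans as1; rewrite divr_gt0.
have e1 : (t * s <= l)%R by rewrite mulrC -ler_pdivlMr.
have e2 : (l <= 2 * (t * s))%R.
  by move: as1; rewrite /a -mulrA -invfM ler_pdivrMr ?mulr_gt0//; lra.
rewrite /f/= indicE mem_set ?mule1; last by split.
rewrite /F1 /g !patchE !mem_set; [|exact/gt0_halfline|exact/gt0_halfline].
rewrite -muleA -EFinM [leRHS]muleC.
apply: (@le_trans _ _ (c%:E * (K%:E * F s))).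
  by rewrite lee_wpmul2l ?lee_fin// dF//; lra.
rewrite muleA -EFinM lee_wpmul2r ?F0// lee_fin.
rewrite (_ : c * K = a^-1 * t^-1)%R; last by rewrite /c; field; rewrite !gt_eqF.
by rewrite ler_pM2r ?invr_gt0// lef_pV2.
Qed.

Lemma Lq_haar_inv_le (q : \bar R) (K : R) : 0 < q -> (0 < K)%R ->
  exists2 C : R, (0 < C)%R & forall (G : R -> \bar R) (l : R), (0 < l)%R ->
    measurable_fun D G -> (forall t, (0 < t)%R -> 0 <= G t) -> doubling K G ->
    Lq_haar q (fun t => G (l / t)%R) <= C%:E * Lq_haar q G.
Proof.
case: q => [r| |]// q0 K0; last first.
  exists 1%R => // G l l0 mG G0 dG; rewrite mul1e.
  apply: ge_ereal_sup => _ [t /= t0 <-].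
  by apply: ereal_sup_ubound; exists (l / t)%R => //=; rewrite divr_gt0.
rewrite lte_fin in q0.
exists ((2 * K `^ r) `^ r^-1)%R; first by rewrite powR_gt0// mulr_gt0// powR_gt0.
move=> G l l0 mG G0 dG; rewrite /Lq_haar.
have F0 t : D t -> 0 <= G t `^ r * (t^-1)%:E.
  by move=> /gt0_halfline t0; rewrite mule_ge0 ?poweR_ge0// lee_fin invr_ge0 ltW.
rewrite -poweR_EFin -poweRM; last 2 first.
- by rewrite lee_fin mulr_ge0// powR_ge0.
- exact: integral_ge0.
apply: poweR_ge0_le; rewrite ?invr_gt0//.
  by apply: integral_ge0 => t /gt0_halfline t0; rewrite mule_ge0 ?poweR_ge0// lee_fin invr_ge0 ltW.
apply: (integral_haar_inv_le (F := fun t => G t `^ r) l0).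
- exact: powR_gt0.
- exact: (measurableT_comp (measurable_poweR r) mG).
- by move=> t t0; exact: poweR_ge0.
- move=> s s' s0 s1 s2; rewrite -poweR_EFin -poweRM ?lee_fin ?(ltW K0) ?G0//.
  apply: poweR_ge0_le => //; last exact: dG.
  by apply: G0; exact: lt_le_trans s1.
Qed.

End inversion.

(** * Mixed norms *)

Section tuples.
Context (R : realType).

Definition tpos n (t : n.-tuple R) := forall j, 0 < tnth t j.

Lemma tpos_tcons n (t1 : R) (t' : n.-tuple R) :
  0 < t1 -> tpos t' -> tpos (tcons (t1, t')).
Proof.
move=> t10 t'0 j; rewrite (tnth_nth 0); case: j => -[|j] jn //=.
by have := t'0 (Ordinal (jn : (j < n)%N)); rewrite (tnth_nth 0).
Qed.

Lemma tpos_behead n (t : n.+1.-tuple R) : tpos t -> tpos [tuple of behead t].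
Proof. by move=> t0 j; rewrite tnth_behead. Qed.

Lemma tcons_eta n (t : n.+1.-tuple R) : tcons (thead t, [tuple of behead t]) = t.
Proof. by apply/val_inj => /=; case: t => -[|x s]. Qed.

Lemma tnth_tcons0 n (t1 : R) (t' : n.-tuple R) : tnth (tcons (t1, t')) ord0 = t1.
Proof. by rewrite (tnth_nth 0). Qed.

Lemma tnth_tconsS n (t1 : R) (t' : n.-tuple R) j :
  tnth (tcons (t1, t')) (lift ord0 j) = tnth t' j.
Proof. by rewrite !(tnth_nth 0). Qed.

Lemma tnth_beheadS (T : Type) n (t : n.+1.-tuple T) j :
  tnth [tuple of behead t] j = tnth t (lift ord0 j).
Proof.
by rewrite tnth_behead; congr tnth; apply/val_inj => /=; rewrite inordK// ltnS.
Qed.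

Lemma thead_tcons n (t1 : R) (t' : n.-tuple R) : thead (tcons (t1, t')) = t1.
Proof. by rewrite /thead (tnth_nth 0). Qed.

Lemma behead_tcons n (t1 : R) (t' : n.-tuple R) :
  [tuple of behead (tcons (t1, t'))] = t'.
Proof. exact/val_inj. Qed.

Definition powprod n (e t : n.-tuple R) : R := \prod_(j < n) tnth t j `^ tnth e j.

Lemma powprod_tcons n (e : n.+1.-tuple R) (t1 : R) (t' : n.-tuple R) :
  powprod e (tcons (t1, t')) = t1 `^ thead e * powprod [tuple of behead e] t'.
Proof.
rewrite /powprod big_ord_recl tnth_tcons0; congr (_ * _).
by apply: eq_bigr => j _; rewrite tnth_beheadS tnth_tconsS.
Qed.

Lemma powprod_gt0 n (e t : n.-tuple R) : tpos t -> 0 < powprod e t.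
Proof. by move=> t0; apply: prodr_gt0 => j _; exact: powR_gt0. Qed.

Definition tdiv n (l t : n.-tuple R) : n.-tuple R :=
  [tuple tnth l j / tnth t j | j < n].

Lemma tpos_tdiv n (l t : n.-tuple R) : tpos l -> tpos t -> tpos (tdiv l t).
Proof. by move=> l0 t0 j; rewrite tnth_mktuple divr_gt0. Qed.

Lemma tdiv_tcons n (l : n.+1.-tuple R) (t1 : R) (t' : n.-tuple R) :
  tdiv l (tcons (t1, t')) = tcons (thead l / t1, tdiv [tuple of behead l] t').
Proof.
apply: eq_from_tnth => j; rewrite tnth_mktuple.
case: (unliftP ord0 j) => [k|] ->.
  by rewrite !tnth_tconsS tnth_mktuple tnth_beheadS.
by rewrite !tnth_tcons0.
Qed.

End tuples.

Section mixed_norm_theory.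
Local Open Scope ereal_scope.
Context (R : realType).
Notation mu := (@lebesgue_measure R).
Local Notation D := (`]0%R, +oo[%classic : set R).

Definition qpos n (q : n.-tuple (\bar R)) := forall j, 0 < tnth q j.

Lemma qpos_behead n (q : n.+1.-tuple (\bar R)) : qpos q -> qpos [tuple of behead q].
Proof. by move=> q0 j; rewrite tnth_behead. Qed.

Definition nonneg n (G : n.-tuple R -> \bar R) := forall t, tpos t -> 0 <= G t.

Lemma nonneg_Lq_haar n (q : n.+1.-tuple (\bar R)) (G : n.+1.-tuple R -> \bar R) :
  nonneg G -> nonneg (fun t' => Lq_haar (thead q) (fun t1 => G (tcons (t1, t')))).
Proof.
by move=> G0 t' t'0; apply: Lq_haar_ge0 => t1 t10; exact/G0/tpos_tcons.
Qed.

Lemma le_mixed_norm n (q : n.-tuple (\bar R)) (G H : n.-tuple R -> \bar R) :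
  qpos q -> nonneg G -> (forall t, tpos t -> G t <= H t) ->
  mixed_norm q G <= mixed_norm q H.
Proof.
elim: n q G H => [|n IH] q G H q0 G0 GH /=; first by apply: GH => -[].
apply: IH; [exact: qpos_behead|exact: nonneg_Lq_haar|move=> t' t'0].
apply: le_Lq_haar => [|t1 t10|t1 t10]; first exact: q0.
  exact/G0/tpos_tcons.
exact/GH/tpos_tcons.
Qed.

Lemma eq_mixed_norm n (q : n.-tuple (\bar R)) (G H : n.-tuple R -> \bar R) :
  qpos q -> nonneg G -> (forall t, tpos t -> G t = H t) ->
  mixed_norm q G = mixed_norm q H.
Proof.
move=> q0 G0 GH; apply/eqP; rewrite eq_le; apply/andP; split; apply: le_mixed_norm => //.
- by move=> t /GH ->.
- by move=> t t0; rewrite -GH//; exact: G0.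
- by move=> t /GH ->.
Qed.

Lemma mixed_normZ n (q : n.-tuple (\bar R)) (G : n.-tuple R -> \bar R) (c : R) :
  qpos q -> (0 < c)%R -> nonneg G ->
  mixed_norm q (fun t => c%:E * G t) = c%:E * mixed_norm q G.
Proof.
move=> q0 c0; elim: n q G q0 => [//|n IH] q G q0 G0 /=.
rewrite -IH; [|exact: qpos_behead|exact: nonneg_Lq_haar].
have cG0 : nonneg (fun t => c%:E * G t).
  by move=> t t0; rewrite mule_ge0 ?G0// lee_fin ltW.
apply: eq_mixed_norm; [exact: qpos_behead|exact: (nonneg_Lq_haar q cG0)|].
move=> t' t'0; apply: Lq_haarZ => //; first exact: q0.
by move=> t1 t10; exact/G0/tpos_tcons.
Qed.

(** Measurability in one variable at a time, in the order in which
   [mixed_norm] integrates: each one-dimensional slice of each of the successive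
   partial norms is a measurable function. *)
Fixpoint mixed_measurable n :
    n.-tuple (\bar R) -> (n.-tuple R -> \bar R) -> Prop :=
  match n with
  | 0 => fun _ _ => True
  | m.+1 => fun q G =>
      (forall t', tpos t' -> measurable_fun D (fun t1 : R => G (tcons (t1, t')))) /\
      mixed_measurable [tuple of behead q]
        (fun t' => Lq_haar (thead q) (fun t1 => G (tcons (t1, t'))))
  end.

Lemma eq_mixed_measurable n (q : n.-tuple (\bar R)) (G H : n.-tuple R -> \bar R) :
  qpos q -> nonneg G -> (forall t, tpos t -> G t = H t) ->
  mixed_measurable q G -> mixed_measurable q H.
Proof.
elim: n q G H => [//|n IH] q G H q0 G0 GH /= [mG1 mG2]; split.
  move=> t' t'0; apply: eq_measurable_fun (mG1 _ t'0) => t1.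
  by rewrite inE => /gt0_halfline t10; apply/GH/tpos_tcons.
apply: IH mG2; [exact: qpos_behead|exact: nonneg_Lq_haar|].
move=> t' t'0; apply: eq_Lq_haar; first exact: q0.
- by move=> t1 t10; exact/G0/tpos_tcons.
- by move=> t1 t10; exact/GH/tpos_tcons.
Qed.

(** One application of [Lq_haar_sup] per variable; the weights lose one
   square root each time. *)
Lemma mixed_norm_sup n (q : n.-tuple (\bar R)) (I : countType) (i0 : I)
    (a : I -> R) : qpos q -> weights a ->
  exists2 C : R, (0 < C)%R &
    forall (psi : I -> n.-tuple R -> \bar R) (H : n.-tuple R -> \bar R),
      (forall i, mixed_measurable q (psi i)) -> (forall i, nonneg (psi i)) ->
      nonneg H ->
      (forall t, tpos t -> H t <= ereal_sup (range (fun i => (a i)%:E * psi i t))) ->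
      mixed_norm q H <= C%:E * ereal_sup (range (fun i => mixed_norm q (psi i))).
Proof.
elim: n q a => [|n IH] q a q0 wa.
  exists 1%R => // psi H _ psi0 _ HG; rewrite mul1e /=.
  apply: le_trans (HG _ _) _; first by case.
  apply: ge_ereal_sup => _ [i _ <-].
  apply: (@le_trans _ _ (psi i [tuple])); last by apply: ereal_sup_ubound; exists i.
  have /andP[_ ai1] := wa.1 i.
  by rewrite gee_pMl ?lee_fin//; apply: psi0 => -[].
have [C1 C10 HC1] := Lq_haar_sup i0 (q0 ord0) wa.
have [C2 C20 HC2] := IH [tuple of behead q] _ (qpos_behead q0) (weights_sqrt wa).
exists (C1 * C2)%R => [|psi H mpsi psi0 H0 HG]; first by rewrite mulr_gt0.
have C1V : (0 < C1^-1)%R by rewrite invr_gt0.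
rewrite /= EFinM -muleA -lee_pdivrMl// -mixed_normZ//; last 2 first.
- exact: qpos_behead.
- exact: nonneg_Lq_haar.
apply: HC2.
- by move=> i; exact: (mpsi i).2.
- by move=> i; exact: nonneg_Lq_haar.
- move=> t' t'0; rewrite mule_ge0 ?lee_fin ?(ltW C1V)//.
  exact: (nonneg_Lq_haar q H0).
- move=> t' t'0; rewrite lee_pdivrMl//; apply: HC1.
  + by move=> i; exact: (mpsi i).1.
  + by move=> i t1 t10; exact/psi0/tpos_tcons.
  + by move=> t1 t10; exact/H0/tpos_tcons.
  + by move=> t1 t10; exact/HG/tpos_tcons.
Qed.

Lemma Lq_haar_pinfty (q : \bar R) (G : R -> \bar R) (tau : R) : 0 < q -> (0 < tau)%R ->
  (forall t, (0 < t)%R -> 0 <= G t) ->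
  (forall t, (0 < t)%R -> (t <= tau)%R -> G t = +oo) -> Lq_haar q G = +oo.
Proof.
case: q => [r| |]// q0 tau0 G0 Goo; last first.
  apply/eqP; rewrite -leye_eq; apply: (@le_trans _ _ (G tau)).
    by rewrite Goo.
  by apply: ereal_sup_ubound; exists tau.
rewrite lte_fin in q0.
rewrite /Lq_haar [X in X `^ _](_ : _ = +oo) ?poweRyr// ?invr_eq0 ?gt_eqF//.
apply/eqP; rewrite -leye_eq integral_mkcond.
have -> : +oo = \int[mu]_x ((cst +oo) \_ `[(tau / 2)%R, tau]) x.
  rewrite integral_cst_itv; last by lra.
  by rewrite gt0_mulye// lte_fin; lra.
apply: ge0_le_integralT => t; first by apply: erestrict_ge0 => y _; rewrite leey.
rewrite /patch; case: ifPn => [|_]; last first.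
  case: ifPn => // /[!inE] /gt0_halfline t0.
  by rewrite mule_ge0 ?poweR_ge0// lee_fin invr_ge0 ltW.
rewrite inE/= in_itv/= => /andP[t1 t2].
have t0 : (0 < t)%R by lra.
rewrite ifT; last by rewrite inE; exact/gt0_halfline.
by rewrite Goo// poweRyr ?gt_eqF// gt0_mulye// lte_fin invr_gt0.
Qed.

(** It makes a function of finite mixed norm which is nonincreasing in each
   variable finite everywhere; see [decay_transform_lty]. *)
Lemma mixed_norm_pinfty n (q : n.-tuple (\bar R)) (G : n.-tuple R -> \bar R) (tau : R) :
  qpos q -> (0 < tau)%R -> nonneg G ->
  (forall t, tpos t -> (forall j, (tnth t j <= tau)%R) -> G t = +oo) ->
  mixed_norm q G = +oo.
Proof.
move=> + tau0; elim: n q G => [|n IH] q G q0 G0 Goo /=; first by apply: Goo => -[].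
apply: IH; [exact: qpos_behead|exact: nonneg_Lq_haar|move=> t' t'0 t'tau].
apply: (Lq_haar_pinfty (q0 ord0) tau0) => [t1 t10|t1 t10 t1tau].
  exact/G0/tpos_tcons.
apply: Goo; first exact: tpos_tcons.
move=> j; rewrite (tnth_nth 0%R); case: j => -[|j] jn //=.
by have := t'tau (Ordinal (jn : (j < n)%N)); rewrite (tnth_nth 0%R).
Qed.

End mixed_norm_theory.

Section power_antitone.
Local Open Scope ereal_scope.
Context (R : realType).
Notation mu := (@lebesgue_measure R).
Local Notation D := (`]0%R, +oo[%classic : set R).

Definition antitone n (phi : n.-tuple R -> \bar R) := forall s t,
  tpos s -> (forall j, (tnth s j <= tnth t j)%R) -> phi t <= phi s.

Lemma le_tpos n (s t : n.-tuple R) : tpos s -> (forall j, (tnth s j <= tnth t j)%R) ->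
  tpos t.
Proof. by move=> s0 st j; apply: lt_le_trans (st j); exact: s0. Qed.

Lemma le_tcons n (s1 t1 : R) (s t : n.-tuple R) : (s1 <= t1)%R ->
  (forall j, (tnth s j <= tnth t j)%R) ->
  forall j, (tnth (tcons (s1, s)) j <= tnth (tcons (t1, t)) j)%R.
Proof.
move=> st1 st j; case: (unliftP ord0 j) => [k|] ->.
  by rewrite !tnth_tconsS.
by rewrite !tnth_tcons0.
Qed.

Lemma measurable_antitone1 (h : R -> \bar R) :
  (forall s t, (0 < s)%R -> (s <= t)%R -> h t <= h s) -> measurable_fun D h.
Proof.
move=> hanti mD; apply: (measurability _ (ErealGenOInfty.measurableE R)) => //= _ [_ [r ->] <-].
apply: is_interval_measurable => s t /=.
rewrite !in_itv/= !andbT => -[s0 sr] [t0 tr] u /andP[su ut].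
have u0 : (0 < u)%R by exact: lt_le_trans su.
by split; rewrite ?in_itv/= ?andbT//; apply: (lt_le_trans tr); exact: hanti.
Qed.

Section step.
Variables (n : nat) (q : n.+1.-tuple (\bar R)) (e : n.+1.-tuple R).
Variable phi : n.+1.-tuple R -> \bar R.
Hypotheses (q0 : qpos q) (phi0 : nonneg phi) (phianti : antitone phi).

Lemma slice_antitone (s' : n.-tuple R) : tpos s' ->
  forall s t, (0 < s)%R -> (s <= t)%R -> phi (tcons (t, s')) <= phi (tcons (s, s')).
Proof.
by move=> s'0 s t s0 st; apply: phianti; [exact: tpos_tcons|exact: le_tcons].
Qed.

Lemma measurable_power_slice (c : R) (s' : n.-tuple R) : tpos s' ->
  measurable_fun D (fun t1 : R => (t1 `^ c)%:E * phi (tcons (t1, s'))).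
Proof.
move=> s'0; apply: emeasurable_funM.
  apply: measurable_funTS; apply/measurable_EFinP; exact: measurable_powR.
by apply: measurable_antitone1; exact: slice_antitone.
Qed.

Lemma measurable_inv1 (h : R -> \bar R) (l : R) : (0 < l)%R ->
  measurable_fun D h -> measurable_fun D (fun t => h (l / t)%R).
Proof.
move=> l0 mh; apply: (@measurable_comp _ _ _ _ _ _ D h) => //.
  by move=> _ [t /gt0_halfline t0 <-]; apply/gt0_halfline; rewrite divr_gt0.
apply: open_continuous_measurable_fun => //.
by move=> t; rewrite inE => /gt0_halfline t0; apply: cvgMr; apply: cvgV => //; rewrite gt_eqF.
Qed.

Lemma antitone_Lq_haar_inv (c l : R) : (0 < l)%R ->
  nonneg (fun s' => Lq_haar (thead q)
    (fun t1 => ((l / t1) `^ c)%:E * phi (tcons ((l / t1)%R, s')))) /\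
  antitone (fun s' => Lq_haar (thead q)
    (fun t1 => ((l / t1) `^ c)%:E * phi (tcons ((l / t1)%R, s')))).
Proof.
move=> l0; split.
  move=> s' s'0; apply: Lq_haar_ge0 => t1 t10.
  rewrite mule_ge0 ?lee_fin ?powR_ge0//; apply/phi0/tpos_tcons => //.
  by rewrite divr_gt0.
move=> s t s0 st; apply: le_Lq_haar => [|t1 t10|t1 t10]; first exact: q0.
  rewrite mule_ge0 ?lee_fin ?powR_ge0//; apply/phi0/tpos_tcons.
    by rewrite divr_gt0.
  exact: le_tpos st.
rewrite lee_wpmul2l ?lee_fin ?powR_ge0//; apply: phianti.
  by apply: tpos_tcons => //; rewrite divr_gt0.
exact: le_tcons.
Qed.

Lemma antitone_Lq_haar (c : R) :
  nonneg (fun s' => Lq_haar (thead q) (fun t1 => (t1 `^ c)%:E * phi (tcons (t1, s')))) /\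
  antitone (fun s' => Lq_haar (thead q) (fun t1 => (t1 `^ c)%:E * phi (tcons (t1, s')))).
Proof.
split.
  move=> s' s'0; apply: Lq_haar_ge0 => t1 t10.
  by rewrite mule_ge0 ?lee_fin ?powR_ge0//; exact/phi0/tpos_tcons.
move=> s t s0 st; apply: le_Lq_haar => [|t1 t10|t1 t10]; first exact: q0.
  rewrite mule_ge0 ?lee_fin ?powR_ge0//; apply/phi0/tpos_tcons => //.
  exact: le_tpos st.
rewrite lee_wpmul2l ?lee_fin ?powR_ge0//; apply: phianti.
  exact: tpos_tcons.
exact: le_tcons.
Qed.

(** From s to a point of the interval from s / 2 to s, the antitone factor
   increases and the power loses at most 2^c. *)
Lemma doubling_power_slice (c : R) (s' : n.-tuple R) : (0 <= c)%R -> tpos s' ->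
  doubling (2 `^ c) (fun t1 : R => (t1 `^ c)%:E * phi (tcons (t1, s'))).
Proof.
move=> c0 s'0 s t t0 ts st; rewrite muleA -EFinM -powRM ?(ltW t0)//.
have s0 : (0 < s)%R by exact: lt_le_trans ts.
apply: lee_pmul; rewrite ?lee_fin ?powR_ge0//.
- exact/phi0/tpos_tcons.
- by apply: ge0_ler_powR => //; rewrite nnegrE ?mulr_ge0// ltW.
- exact: slice_antitone.
Qed.

End step.

(** A product of powers and of an antitone function is preserved, up to the
   dimension, by taking the norm in the first variable; and monotone functions
   of one variable are measurable. *)
Lemma mixed_measurable_tdiv n (q : n.-tuple (\bar R)) (e l : n.-tuple R)
    (phi : n.-tuple R -> \bar R) :
  qpos q -> tpos l -> nonneg phi -> antitone phi ->
  mixed_measurable q (fun t => (powprod e (tdiv l t))%:E * phi (tdiv l t)).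
Proof.
elim: n q e l phi => [//|n IH] q e l phi q0 l0 phi0 phianti /=; split.
  move=> t' t'0; have il0 := tpos_tdiv (tpos_behead l0) t'0.
  rewrite (_ : (fun _ => _) = fun t1 => (powprod [tuple of behead e] (tdiv [tuple of behead l] t'))%:E *
     (((thead l / t1) `^ thead e)%:E * phi (tcons ((thead l / t1)%R, tdiv [tuple of behead l] t')))); last first.
    by apply/funext => t1; rewrite tdiv_tcons powprod_tcons mulrC EFinM muleA.
  apply: measurable_funeM.
  exact: (measurable_inv1 (l0 ord0) (measurable_power_slice phianti (thead e) il0)).
have [chi0 chianti] := antitone_Lq_haar_inv q0 phi0 phianti (thead e) (l0 ord0).
have := IH [tuple of behead q] [tuple of behead e] [tuple of behead l] _
  (qpos_behead q0) (tpos_behead l0) chi0 chianti.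
apply: eq_mixed_measurable; first exact: qpos_behead.
  move=> t' t'0; have il0 := tpos_tdiv (tpos_behead l0) t'0.
  by rewrite mule_ge0 ?chi0// lee_fin ltW// powprod_gt0.
move=> t' t'0; have il0 := tpos_tdiv (tpos_behead l0) t'0.
rewrite -Lq_haarZ; [|exact: q0|exact: powprod_gt0|]; last first.
  move=> t1 t10; rewrite mule_ge0 ?lee_fin ?powR_ge0//; apply/phi0/tpos_tcons => //.
  by rewrite divr_gt0//; exact: l0.
congr Lq_haar; apply/funext => t1.
by rewrite tdiv_tcons powprod_tcons [in RHS]mulrC EFinM muleA.
Qed.

(** In the first variable this is [Lq_haar_inv_le]; what remains is again a
   product of powers and of an antitone function, namely of the norms of the
   slices. *)
Lemma mixed_norm_tdiv_le n (q : n.-tuple (\bar R)) (e : n.-tuple R) :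
  qpos q -> (forall j, (0 <= tnth e j)%R) ->
  exists2 C : R, (0 < C)%R & forall (l : n.-tuple R) (phi : n.-tuple R -> \bar R),
    tpos l -> nonneg phi -> antitone phi ->
    mixed_norm q (fun t => (powprod e (tdiv l t))%:E * phi (tdiv l t)) <=
    C%:E * mixed_norm q (fun t => (powprod e t)%:E * phi t).
Proof.
elim: n q e => [|n IH] q e q0 e0.
  exists 1%R => // l phi _ _ _; rewrite mul1e /=.
  by rewrite (tuple0 (tdiv _ _)).
have K0 : (0 < 2 `^ thead e :> R)%R by exact: powR_gt0.
have [C1 C10 HC1] := Lq_haar_inv_le (q0 ord0) K0.
have e'0 j : (0 <= tnth [tuple of behead e] j)%R by rewrite tnth_behead.
have [C2 C20 HC2] := IH _ _ (qpos_behead q0) e'0.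
exists (C1 * C2)%R => [|l phi l0 phi0 phianti]; first by rewrite mulr_gt0.
have [chi0 chianti] := antitone_Lq_haar q0 phi0 phianti (thead e).
set chi := fun s' => _ in chi0 chianti.
have Pchi0 : nonneg (fun t' => (powprod [tuple of behead e] t')%:E * chi t').
  by move=> t' t'0; rewrite mule_ge0 ?chi0// lee_fin ltW// powprod_gt0.
have il0 t' : tpos t' -> tpos (tdiv [tuple of behead l] t').
  by move=> t'0; apply: tpos_tdiv => //; exact: tpos_behead.
rewrite /=; apply: (@le_trans _ _ (mixed_norm [tuple of behead q] (fun t' =>
   C1%:E * ((powprod [tuple of behead e] (tdiv [tuple of behead l] t'))%:E *
            chi (tdiv [tuple of behead l] t'))))).
  apply: le_mixed_norm; first exact: qpos_behead.
    apply: (@nonneg_Lq_haar _ _ q (fun t => (powprod e (tdiv l t))%:E * phi (tdiv l t))).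
    move=> t t0; have it0 := tpos_tdiv l0 t0.
    by rewrite mule_ge0 ?phi0// lee_fin ltW// powprod_gt0.
  move=> t' t'0; have it'0 := il0 _ t'0.
  rewrite (_ : (fun t1 => _) = fun t1 => (powprod [tuple of behead e] (tdiv [tuple of behead l] t'))%:E *
     (((thead l / t1) `^ thead e)%:E * phi (tcons ((thead l / t1)%R, tdiv [tuple of behead l] t')))); last first.
    by apply/funext => t1; rewrite tdiv_tcons powprod_tcons mulrC EFinM muleA.
  rewrite Lq_haarZ; [|exact: q0|exact: powprod_gt0|]; last first.
    move=> t1 t10; rewrite mule_ge0 ?lee_fin ?powR_ge0//; apply/phi0/tpos_tcons => //.
    by rewrite divr_gt0//; exact: l0.
  rewrite [leRHS]muleCA lee_wpmul2l ?lee_fin ?(ltW (powprod_gt0 _ it'0))//.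
  apply: (HC1 (fun t1 => (t1 `^ thead e)%:E * phi (tcons (t1, tdiv [tuple of behead l] t')))).
  - exact: l0.
  - exact: measurable_power_slice.
  - move=> t1 t10; rewrite mule_ge0 ?lee_fin ?powR_ge0//; exact/phi0/tpos_tcons.
  - by apply: doubling_power_slice => //; exact: e0.
rewrite mixed_normZ//; last 2 first.
- exact: qpos_behead.
- by move=> t' t'0; exact: Pchi0 (il0 _ t'0).
rewrite EFinM -muleA lee_wpmul2l ?lee_fin ?(ltW C10)//.
apply: (le_trans (HC2 _ _ (tpos_behead l0) chi0 chianti)).
rewrite lee_wpmul2l ?lee_fin ?(ltW C20)//.
apply: le_mixed_norm => //; first exact: qpos_behead.
move=> t' t'0; rewrite -Lq_haarZ; [|exact: q0|exact: powprod_gt0|]; last first.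
  by move=> t1 t10; rewrite mule_ge0 ?lee_fin ?powR_ge0//; exact/phi0/tpos_tcons.
apply: le_Lq_haar => [|t1 t10|t1 t10]; first exact: q0.
  rewrite !mule_ge0 ?lee_fin ?powR_ge0 ?(ltW (powprod_gt0 _ _))//.
  exact/phi0/tpos_tcons.
by rewrite powprod_tcons mulrC EFinM muleA.
Qed.

End power_antitone.

(** * The decaying kernel on R^n *)

Section integral_rn.
Local Open Scope ereal_scope.
Context (R : realType).

Lemma ge0_integral_rn0 (F : 0.-tuple R -> \bar R) : measurable_fun setT F ->
  \int[lebesgue_rn R 0]_x F x = F [tuple].
Proof. by move=> mF; rewrite /= integral_dirac// diracT mul1e. Qed.

Lemma measurable_slice n (F : n.+1.-tuple R -> \bar R) : measurable_fun setT F ->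
  measurable_fun setT (F \o @tcons R n).
Proof. by move=> mF; apply: measurableT_comp => //; exact: measurable_tcons. Qed.

(** The first variable is integrated first, as in the repeated
   rearrangement. *)
Lemma ge0_integral_rnS n (F : n.+1.-tuple R -> \bar R) :
  measurable_fun setT F -> (forall x, 0 <= F x) ->
  \int[lebesgue_rn R n.+1]_x F x =
  \int[lebesgue_rn R n]_x' \int[lebesgue_measure]_x1 F (tcons (x1, x')).
Proof.
move=> mF F0.
have <- : \int[(lebesgue_measure \x lebesgue_rn R n)%E]_z (F \o @tcons R n) z =
    \int[lebesgue_rn R n]_x' \int[lebesgue_measure]_x1 F (tcons (x1, x')).
  by apply: fubini_tonelli2 => [|z]; [exact: measurable_slice|exact: F0].
rewrite -(preimage_setT (@tcons R n)).
apply: (ge0_integral_pushforward (@measurable_tcons R n)) => //.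
Qed.

End integral_rn.

Section kernel_rn.
Context (R : realType).

Definition mdecay n (t x : n.-tuple R) : R := \prod_(j < n) decay (tnth t j) (tnth x j).

Lemma mdecay_gt0 n (t x : n.-tuple R) : 0 < mdecay t x.
Proof. by apply: prodr_gt0 => j _; exact: decay_gt0. Qed.

Lemma mdecay_tcons n (t1 x1 : R) (t x : n.-tuple R) :
  mdecay (tcons (t1, t)) (tcons (x1, x)) = decay t1 x1 * mdecay t x.
Proof.
rewrite /mdecay big_ord_recl !tnth_tcons0; congr (_ * _).
by apply: eq_bigr => j _; rewrite !tnth_tconsS.
Qed.

Lemma measurable_mdecay n (t : n.-tuple R) : measurable_fun setT (mdecay t).
Proof.
rewrite /mdecay; apply: measurable_prod => j _.
by apply: measurableT_comp; [exact: measurable_decay|exact: measurable_tnth].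
Qed.

Lemma measurable_mdecayV n (t : n.-tuple R) :
  measurable_fun setT (fun x => (mdecay t x)^-1).
Proof.
rewrite (_ : (fun _ => _) = (fun x => \prod_(j < n) (decay (tnth t j) (tnth x j))^-1)).
  apply: measurable_prod => j _.
  apply: (measurableT_comp (continuous_measurable_fun (@continuous_decayV R (tnth t j)))).
  exact: measurable_tnth.
by apply/funext => x; rewrite /mdecay -prodfV.
Qed.

End kernel_rn.

Section indices.
Context (R : realType).

(** In each coordinate, the pair (j, i) consists of the number j of a shell of
   the kernel and of the number i of a level set of the function. *)
Fixpoint midx (n : nat) : countType :=
  match n with 0 => unit | m.+1 => ((nat * nat) * midx m)%type end.

Fixpoint midx0 (n : nat) : midx n :=
  match n return midx n with 0 => tt | m.+1 => ((0%N, 0%N), midx0 m) end.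

Definition dilation (k : nat * nat) : R := 2 ^+ k.1.+1 * 2^-1 ^+ k.2.

Lemma dilation_gt0 k : 0 < dilation k.
Proof. by rewrite mulr_gt0// exprn_gt0// invr_gt0. Qed.

(** Decay of the weights in the index of the shells of the kernel; its square is
   2^(-1/p), which is smaller than 1 because p is finite. *)
Definition rate1 (p : R) : R := 2 `^ (- (p^-1 / 2)).
(** Decay of the weights in the index of the level sets; its square is
   2^(1/p - 1), which is smaller than 1 because 1 < p. *)
Definition rate2 (p : R) : R := 2 `^ ((p^-1 - 1) / 2).
Definition weight (p : R) (k : nat * nat) : R := rate1 p ^+ k.1 * rate2 p ^+ k.2.

Lemma powR2_lt1 (c : R) : c < 0 -> 0 < (2 : R) `^ c < 1.
Proof.
move=> c0; rewrite powR_gt0//= -(opprK c) powRN invf_lt1 ?powR_gt0//.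
have := @gt0_ltr_powR _ (- c) _ 1 2; rewrite powR1; apply; rewrite ?nnegrE//.
  by rewrite oppr_gt0.
by rewrite ltr1n.
Qed.

Lemma rate1_lt1 p : 1 < p -> 0 < rate1 p < 1.
Proof.
by move=> p1; apply: powR2_lt1; rewrite oppr_lt0 divr_gt0// invr_gt0; lra.
Qed.

Lemma rate2_lt1 p : 1 < p -> 0 < rate2 p < 1.
Proof.
move=> p1; apply: powR2_lt1; have : p^-1 < 1 by rewrite invf_lt1//; lra.
by lra.
Qed.

Lemma weight_gt0 p k : 0 < weight p k.
Proof. by rewrite mulr_gt0// exprn_gt0// powR_gt0. Qed.

Lemma weights_weight p : 1 < p -> weights (weight p).
Proof.
move=> p1; apply: (weights_prod (I := nat) (J := nat)).
  exact/weights_geometric/rate1_lt1.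
exact/weights_geometric/rate2_lt1.
Qed.

Fixpoint mdilation n : midx n -> n.-tuple R :=
  match n return midx n -> n.-tuple R with
  | 0 => fun _ => [tuple]
  | m.+1 => fun k => tcons (dilation k.1, mdilation k.2)
  end.

Lemma tpos_mdilation n (k : midx n) : tpos (mdilation k).
Proof.
elim: n k => [|n IH] k /=; first by case.
by apply: tpos_tcons => //; exact: dilation_gt0.
Qed.

Fixpoint mweight n : n.-tuple R -> midx n -> R :=
  match n return n.-tuple R -> midx n -> R with
  | 0 => fun _ _ => 1
  | m.+1 => fun p k => weight (thead p) k.1 * mweight [tuple of behead p] k.2
  end.

Lemma mweight_gt0 n (p : n.-tuple R) k : 0 < mweight p k.
Proof.
by elim: n p k => [//|n IH] p k /=; rewrite mulr_gt0 ?weight_gt0.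
Qed.

Lemma weights_mweight n (p : n.-tuple R) : (forall j, 1 < tnth p j) ->
  weights (mweight p).
Proof.
elim: n p => [|n IH] p p1 /=; first exact: weights_unit.
apply: (weights_prod (I := (nat * nat)%type) (J := midx n)).
  by apply: weights_weight; exact: p1.
by apply: IH => j; rewrite tnth_behead.
Qed.

(** The coefficient of a term of the expansion on the line, once the powers of
   t prescribed by the norms have been distributed.  For s = 2^(j+1-i) / t the
   equality t^(-1/p) = (s / 2^(j+1-i))^(1/p) leaves a factor
   2^(-1/p) 2^(-j/p) 2^(-i (1 - 1/p)), at most the square of the weight. *)
Lemma dyadic_coef (p t : R) (j i : nat) : 1 < p -> 0 < t ->
  t `^ (1 - p^-1) * (16 * 2^-1 ^+ i / t) <=
  16 * (rate1 p ^+ j * rate2 p ^+ i) *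
    (weight p (j, i) * (dilation (j, i) / t) `^ p^-1).
Proof.
move=> p1 t0; set c := p^-1.
have c0 : 0 < c by rewrite invr_gt0; lra.
have X0 : 0 < (2:R) `^ c by exact: powR_gt0.
set X := 2 `^ c in X0.
have X1 : 1 <= X by rewrite -[leLHS](powRr0 2) ler_powR ?ler1n// ltW.
have r1 : rate1 p ^+ 2 = X^-1.
  rewrite /rate1 -powR_mulrn ?powR_ge0// -powRrM -/c.
  by rewrite (_ : - (c / 2) * 2%:R = - c) ?powRN//; field.
have r2 : rate2 p ^+ 2 = X / 2.
  rewrite /rate2 -powR_mulrn ?powR_ge0// -powRrM -/c.
  rewrite (_ : (c - 1) / 2 * 2%:R = c - 1); last by field.
  by rewrite powRB ?pnatr_eq0 ?implybT// powRr1.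
have expX (k : nat) : (2 ^+ k : R) `^ c = X ^+ k.
  by rewrite -[in LHS]powR_mulrn// -powRrM mulrC powRrM powR_mulrn ?powR_ge0.
have T0 : 0 < t `^ c by exact: powR_gt0.
have -> : t `^ (1 - c) = t / t `^ c.
  by rewrite powRB ?(gt_eqF t0) ?implybT// powRr1// ltW.
have -> : (dilation (j, i) / t) `^ c = X ^+ j.+1 / X ^+ i / t `^ c.
  rewrite /dilation/= exprVn powRM ?divr_ge0 ?exprn_ge0 ?invr_ge0 ?(ltW t0)//.
  rewrite powRM ?exprn_ge0 ?invr_ge0 ?exprn_ge0// expX.
  rewrite -(powR_inv1 (ltW t0)) -powRrM mulN1r powRN.
  by rewrite -powR_inv1 ?exprn_ge0// -powRrM mulN1r powRN expX.
rewrite /weight/= mulrA (_ : 16 * (rate1 p ^+ j * rate2 p ^+ i) * (rate1 p ^+ j * rate2 p ^+ i)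
  = 16 * ((rate1 p ^+ 2) ^+ j * (rate2 p ^+ 2) ^+ i)); last first.
  by rewrite -!exprM !(mulnC 2) !exprM; ring.
rewrite r1 r2 exprS !exprMn !exprVn.
have Xi : 0 < X ^+ i by exact: exprn_gt0.
have Xj : 0 < X ^+ j by exact: exprn_gt0.
have -> : t / t `^ c * (16 * (2 ^+ i)^-1 / t) = 16 * (2 ^+ i)^-1 / t `^ c.
  by field; rewrite !gt_eqF// exprn_gt0.
have -> : 16 * ((X ^+ j)^-1 * (X ^+ i * (2 ^+ i)^-1)) * (X * X ^+ j / X ^+ i / t `^ c) =
   16 * (2 ^+ i)^-1 / t `^ c * X.
  by field; rewrite !gt_eqF// exprn_gt0.
by rewrite ler_peMr// !mulr_ge0// invr_ge0 ?exprn_ge0// ltW.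
Qed.

End indices.

Section iterated.
Local Open Scope ereal_scope.
Context (R : realType).

Lemma nneseries2_le (c : nat -> nat -> R) (v : nat -> nat -> \bar R) (Y : \bar R) :
  (forall j i, 0 <= v j i) -> (forall j i, v j i <= (c j i)%:E * Y) ->
  forall u1 u2 : R, (0 < u1 < 1)%R -> (0 < u2 < 1)%R -> 0 <= Y ->
  (forall j i, c j i = u1 ^+ j * u2 ^+ i)%R ->
  \sum_(j <oo) \sum_(i <oo) v j i <= ((1 - u1)^-1 * (1 - u2)^-1)%:E * Y.
Proof.
move=> v0 vc u1 u2 /andP[u10 u11] /andP[u20 u21] Y0 cE.
have U10 : (0 < (1 - u1)^-1)%R by rewrite invr_gt0 subr_gt0.
have U20 : (0 < (1 - u2)^-1)%R by rewrite invr_gt0 subr_gt0.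
case: Y Y0 vc => [y| |]// Y0 vc; last first.
  by rewrite gt0_muley ?leey// lte_fin mulr_gt0.
rewrite lee_fin in Y0.
apply: (@le_trans _ _ (\sum_(j <oo) \sum_(i <oo) (y * u1 ^+ j)%:E * (u2 ^+ i)%:E)).
  apply: lee_nneseries => [j _ _|j _]; first exact: nneseries_ge0.
  apply: lee_nneseries => // i _; apply: (le_trans (vc j i)).
  by rewrite -!EFinM lee_fin cE mulrC mulrA.
rewrite (eq_eseriesr (g := fun j => (y * (1 - u2)^-1)%:E * (u1 ^+ j)%:E)); last first.
  move=> j _; rewrite nneseriesZl; last by move=> i _; rewrite lee_fin exprn_ge0// ltW.
  by rewrite nneseries_geometric ?(ltW u20)// -!EFinM mulrAC.
rewrite nneseriesZl; last by move=> i _; rewrite lee_fin exprn_ge0// ltW.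
rewrite nneseries_geometric ?(ltW u10)// -!EFinM lee_fin.
by rewrite le_eqVlt; apply/orP; left; apply/eqP; ring.
Qed.

Definition inv_exp n (p : n.-tuple R) : n.-tuple R := [tuple (tnth p j)^-1%R | j < n].
(** The inverses of the conjugate exponents p'_j. *)
Definition coinv_exp n (p : n.-tuple R) : n.-tuple R :=
  [tuple (1 - (tnth p j)^-1)%R | j < n].

Lemma behead_inv_exp n (p : n.+1.-tuple R) :
  [tuple of behead (inv_exp p)] = inv_exp [tuple of behead p].
Proof.
by apply: eq_from_tnth => j; rewrite tnth_beheadS !tnth_mktuple tnth_beheadS.
Qed.

Lemma behead_coinv_exp n (p : n.+1.-tuple R) :
  [tuple of behead (coinv_exp p)] = coinv_exp [tuple of behead p].
Proof.
by apply: eq_from_tnth => j; rewrite tnth_beheadS !tnth_mktuple tnth_beheadS.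
Qed.

(** Tonelli, with [integral_decay_le_rearrange1] in the first variable.  The
   rearrangement in that variable at a fixed point is a function of n
   variables, to which the same treatment can be applied. *)
Lemma integral_mdecay_step n (g : n.+1.-tuple R -> \bar R) (t1 : R) (t' : n.-tuple R) :
  measurable_fun setT g -> (forall x, 0 <= g x) -> (0 < t1)%R ->
  \int[lebesgue_rn R n.+1]_x (g x * (mdecay (tcons (t1, t')) x)%:E) <=
  \sum_(j <oo) \sum_(i <oo) (16 * 2^-1 ^+ i / t1)%:E *
    \int[lebesgue_rn R n]_x'
      (rearrange1 (fun x1 => g (tcons (x1, x'))) (dilation R (j, i) / t1) * (mdecay t' x')%:E).
Proof.
move=> mg g0 t10.
have s0 j i : (0 <= dilation R (j, i) / t1)%R by rewrite divr_ge0 ?ltW// dilation_gt0.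
have c0 i : (0 <= 16 * 2^-1 ^+ i / t1)%R.
  by rewrite divr_ge0 ?mulr_ge0 ?exprn_ge0 ?invr_ge0// ltW.
have K0 x' : (0 < mdecay t' x')%R by exact: mdecay_gt0.
pose h j i x' := (16 * 2^-1 ^+ i / t1)%:E *
  (rearrange1 (fun x1 => g (tcons (x1, x'))) (dilation R (j, i) / t1) * (mdecay t' x')%:E).
have r0 j i x' : 0 <= rearrange1 (fun x1 => g (tcons (x1, x'))) (dilation R (j, i) / t1) * (mdecay t' x')%:E.
  by rewrite mule_ge0 ?rearrange1_ge0// lee_fin ltW.
have h0 j i x' : 0 <= h j i x' by rewrite mule_ge0// lee_fin.
have mr j i : measurable_fun setT (fun x' : n.-tuple R =>
    rearrange1 (fun x1 => g (tcons (x1, x'))) (dilation R (j, i) / t1) * (mdecay t' x')%:E).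
  apply: emeasurable_funM; first exact: measurable_rearrange1.
  by apply/measurable_EFinP; exact: measurable_mdecay.
have mh j i : measurable_fun setT (h j i) by exact: measurable_funeM.
have msum j : measurable_fun setT (fun x' => \sum_(i <oo) h j i x').
  have := @ge0_emeasurable_sum _ _ R setT (h j) xpredT.
  by apply => [i x _ _|i _]; [exact: h0|exact: mh].
rewrite ge0_integral_rnS; last 2 first.
- apply: emeasurable_funM => //; apply/measurable_EFinP; exact: measurable_mdecay.
- by move=> x; rewrite mule_ge0// lee_fin ltW// mdecay_gt0.
apply: (@le_trans _ _ (\int[lebesgue_rn R n]_x' \sum_(j <oo) \sum_(i <oo) h j i x')).
  apply: ge0_le_integralT => x'.
    by apply: integral_ge0 => x1 _; rewrite mule_ge0// lee_fin ltW// mdecay_gt0.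
  have mgx : measurable_fun setT (fun x1 : R => g (tcons (x1, x'))).
    exact: (measurableT_comp (measurable_slice mg) (pair2_measurable x')).
  rewrite (_ : \int[_]_x1 _ = (mdecay t' x')%:E *
      \int[lebesgue_measure]_x1 (g (tcons (x1, x')) * (decay t1 x1)%:E)); last first.
    rewrite -ge0_integralZ_lower//; last first.
      by move=> x1 _; rewrite mule_ge0// lee_fin decay_ge0.
    by apply: eq_integral => x1 _; rewrite mdecay_tcons mulrC EFinM muleCA.
  apply: (@le_trans _ _ ((mdecay t' x')%:E * \sum_(j <oo) \sum_(i <oo)
    (16 * 2^-1 ^+ i / t1)%:E * rearrange1 (fun x1 => g (tcons (x1, x'))) (dilation R (j, i) / t1)%R)).
    rewrite lee_wpmul2l ?lee_fin ?(ltW (K0 x'))//.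
    exact: integral_decay_le_rearrange1.
  rewrite -nneseriesZl; last first.
    by move=> j _; apply: nneseries_ge0 => i _ _; rewrite mule_ge0 ?rearrange1_ge0 ?lee_fin.
  apply: lee_nneseries => [j _ _|j _].
    rewrite mule_ge0 ?lee_fin ?(ltW (K0 x'))//.
    by apply: nneseries_ge0 => i _ _; rewrite mule_ge0 ?rearrange1_ge0 ?lee_fin.
  rewrite -nneseriesZl; last by move=> i _; rewrite mule_ge0 ?rearrange1_ge0 ?lee_fin.
  apply: lee_nneseries => [i _ _|i _].
    by rewrite !mule_ge0 ?rearrange1_ge0 ?lee_fin ?(ltW (K0 x')).
  by rewrite /h muleCA (muleC (mdecay t' x')%:E).
rewrite integral_nneseries//; last by move=> j x' _; apply: nneseries_ge0.
apply: lee_nneseries => [j _ _|j _].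
  by apply: integral_ge0 => x' _; apply: nneseries_ge0.
rewrite integral_nneseries//.
apply: lee_nneseries => [i _ _|i _]; first exact: integral_ge0.
by rewrite /h ge0_integralZl_EFin.
Qed.

Lemma rearrange_tcons n (g : n.+1.-tuple R -> \bar R) (s1 : R) (s' : n.-tuple R) :
  rearrange g (tcons (s1, s')) =
  rearrange (fun x' => rearrange1 (fun x1 => g (tcons (x1, x'))) s1) s'.
Proof.
have -> : rearrange g (tcons (s1, s')) =
    rearrange (fun x' => rearrange1 (fun x1 => g (tcons (x1, x')))
      (thead (tcons (s1, s')))) [tuple of behead (tcons (s1, s'))] by [].
by rewrite thead_tcons behead_tcons.
Qed.

(** Induction on the dimension by [integral_mdecay_step].  The sums are turned
   into a bound by the largest term at the cost of one of the two
   factors weight contained in the coefficient of [dyadic_coef].  The bound X is a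
   variable, so that in the induction it can absorb the power and the
   weight of the first coordinate. *)
Lemma integral_mdecay_le_sup n (p : n.-tuple R) : (forall j, 1 < tnth p j)%R ->
  exists2 B : R, (0 < B)%R & forall (g : n.-tuple R -> \bar R) (t : n.-tuple R) (X : \bar R),
    measurable_fun setT g -> (forall x, 0 <= g x) -> tpos t ->
    (forall k : midx n, (mweight p k)%:E *
       ((powprod (inv_exp p) (tdiv (mdilation R k) t))%:E *
        rearrange g (tdiv (mdilation R k) t)) <= X) ->
    (powprod (coinv_exp p) t)%:E * \int[lebesgue_rn R n]_x (g x * (mdecay t x)%:E) <= B%:E * X.
Proof.
elim: n p => [|n IH] p p1.
  exists 1%R => // g t X mg g0 t0 /(_ tt) gX.
  rewrite ge0_integral_rn0; last first.
    apply: emeasurable_funM => //; apply/measurable_EFinP; exact: measurable_mdecay.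
  move: gX; rewrite /= /powprod /mdecay !big_ord0 !mul1e mule1.
  by rewrite (tuple0 (tdiv _ _)).
have p'1 j : (1 < tnth [tuple of behead p] j)%R by rewrite tnth_behead.
have [B B0 HB] := IH _ p'1.
have pp : (1 < thead p)%R by exact: p1.
pose u1 := rate1 (thead p); pose u2 := rate2 (thead p).
have u101 : (0 < u1 < 1)%R by exact: rate1_lt1.
have u201 : (0 < u2 < 1)%R by exact: rate2_lt1.
exists ((1 - u1)^-1 * (1 - u2)^-1 * (16 * B))%R => [|g t X mg g0 t0 gX].
  case/andP: u101 => _ u11; case/andP: u201 => _ u21.
  by rewrite !mulr_gt0// invr_gt0 subr_gt0.
have X0 : 0 <= X.
  apply: le_trans (gX (midx0 n.+1)); have ts0 := tpos_tdiv (tpos_mdilation R (midx0 n.+1)) t0.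
  rewrite !mule_ge0 ?rearrange_ge0 ?lee_fin ?(ltW (mweight_gt0 _ _))//.
  exact/ltW/powprod_gt0.
rewrite -(tcons_eta t) in t0 gX *.
set t1 := thead t in t0 gX *; set t' := [tuple of behead t] in t0 gX *.
have t10 : (0 < t1)%R by have := t0 ord0; rewrite tnth_tcons0.
have t'0 : tpos t' by have := tpos_behead t0; rewrite behead_tcons.
rewrite powprod_tcons behead_coinv_exp /thead tnth_mktuple -/(thead p).
have P0 : (0 < powprod (coinv_exp [tuple of behead p]) t')%R by exact: powprod_gt0.
set P := powprod (coinv_exp [tuple of behead p]) t' in P0 *.
set T := (t1 `^ (1 - (thead p)^-1))%R.
have T0 : (0 < T)%R by exact: powR_gt0.
pose J (k : nat * nat) := \int[lebesgue_rn R n]_x'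
      (rearrange1 (fun x1 => g (tcons (x1, x'))) (dilation R k / t1) * (mdecay t' x')%:E).
have J0 k : 0 <= J k.
  by apply: integral_ge0 => x' _; rewrite mule_ge0 ?rearrange1_ge0// lee_fin ltW// mdecay_gt0.
pose d k : R := (weight (thead p) k * (dilation R k / t1) `^ (thead p)^-1)%R.
have d0 k : (0 < d k)%R.
  by rewrite mulr_gt0 ?weight_gt0// powR_gt0// divr_gt0// dilation_gt0.
have PJ k : P%:E * J k <= B%:E * ((d k)^-1%:E * X).
  apply: HB => //.
  - by apply: measurable_rearrange1 => //; rewrite divr_ge0 ?(ltW t10)// ltW// dilation_gt0.
  - by move=> x; exact: rearrange1_ge0.
  move=> k'; rewrite lee_pdivlMl//; apply: le_trans (gX (k, k')).
  have -> : mdilation R ((k, k') : midx n.+1) = tcons (dilation R k, mdilation R k') by [].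
  have -> : mweight p ((k, k') : midx n.+1) =
    (weight (thead p) k * mweight [tuple of behead p] k')%R by [].
  rewrite tdiv_tcons thead_tcons behead_tcons powprod_tcons rearrange_tcons.
  rewrite behead_inv_exp /thead tnth_mktuple -/(thead p).
  rewrite !muleA -!EFinM le_eqVlt; apply/orP; left; apply/eqP.
  by congr (_%:E * _); rewrite /d /thead; ring.
apply: (@le_trans _ _ ((T * P)%:E * \sum_(j <oo) \sum_(i <oo) (16 * 2^-1 ^+ i / t1)%:E * J (j, i))).
  rewrite lee_wpmul2l ?lee_fin ?mulr_ge0 ?(ltW T0) ?(ltW P0)//.
  exact: integral_mdecay_step.
have c0 i : (0 <= 16 * 2^-1 ^+ i / t1)%R.
  by rewrite divr_ge0 ?mulr_ge0 ?exprn_ge0 ?invr_ge0// ltW.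
have cJ0 j i : 0 <= (16 * 2^-1 ^+ i / t1)%:E * J (j, i) by rewrite mule_ge0 ?lee_fin.
have TP0 : (0 <= T * P)%R by rewrite mulr_ge0// ltW.
rewrite -nneseriesZl; last by move=> j _; exact: nneseries_ge0.
rewrite (eq_eseriesr (g := fun j => \sum_(i <oo) (T * P)%:E * ((16 * 2^-1 ^+ i / t1)%:E * J (j, i)))); last first.
  by move=> j _; rewrite -nneseriesZl.
have -> : ((1 - u1)^-1 * (1 - u2)^-1 * (16 * B))%:E * X =
    ((1 - u1)^-1 * (1 - u2)^-1)%:E * ((16 * B)%:E * X) by rewrite muleA -EFinM.
apply: (nneseries2_le (c := fun j i => u1 ^+ j * u2 ^+ i)%R) => //.
- by move=> j i; rewrite mule_ge0 ?lee_fin.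
- move=> j i.
  (* One factor weight goes into d, to be absorbed by X; the other one sums the
  double series. *)
  apply: (@le_trans _ _ ((16 * (u1 ^+ j * u2 ^+ i) * d (j, i))%:E * (P%:E * J (j, i)))).
    rewrite EFinM -!muleA (muleCA P%:E) muleA -EFinM muleA -EFinM [leRHS]muleA -EFinM.
    rewrite lee_wpmul2r// lee_fin ler_wpM2r ?(ltW P0)//.
    by rewrite /T /d; exact: dyadic_coef.
  have ud0 : (0 <= 16 * (u1 ^+ j * u2 ^+ i) * d (j, i))%R.
    case/andP: u101 => u10 _; case/andP: u201 => u20 _.
    apply: mulr_ge0; last exact/ltW/d0.
    by apply: mulr_ge0 => //; apply: mulr_ge0; apply: exprn_ge0; exact: ltW.
  apply: (le_trans (lee_wpmul2l _ (PJ (j, i)))); first by rewrite lee_fin.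
  rewrite !muleA -!EFinM le_eqVlt; apply/orP; left; apply/eqP.
  by congr (_%:E * _); field; rewrite gt_eqF.
- by rewrite mule_ge0// lee_fin mulr_ge0// ltW.
Qed.

End iterated.

(** * The Fourier integral of a box *)

Section box_theory.
Local Open Scope ereal_scope.
Context (R : realType).

Lemma box_tcons n (a1 b1 x1 : R) (a b x : n.-tuple R) :
  box (tcons (a1, a)) (tcons (b1, b)) (tcons (x1, x)) <->
  `[a1, b1]%classic x1 /\ box a b x.
Proof.
split=> [h|[h1 h2] j].
  split=> [|j]; first by have := h ord0; rewrite !tnth_tcons0 /= in_itv.
  by have := h (lift ord0 j); rewrite !tnth_tconsS.
case: (unliftP ord0 j) => [k|] ->; first by rewrite !tnth_tconsS; exact: h2.
by rewrite !tnth_tcons0; move: h1; rewrite /= in_itv.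
Qed.

Lemma preimage_tcons_box n (a1 b1 : R) (a b : n.-tuple R) :
  @tcons R n @^-1` box (tcons (a1, a)) (tcons (b1, b)) =
  `[a1, b1]%classic `*` box a b.
Proof. by apply/seteqP; split => -[x1 x] /box_tcons. Qed.

Lemma measurable_box n (a b : n.-tuple R) : measurable (box a b).
Proof.
rewrite (_ : box a b = \bigcap_(j in [set: 'I_n])
    ((fun x : n.-tuple R => tnth x j) @^-1` `[tnth a j, tnth b j]%classic)).
  apply: fin_bigcap_measurable; first exact: finite_finset.
  move=> j _; rewrite -[X in measurable X]setTI.
  by apply: measurable_tnth => //; exact: measurable_itv.
by apply/seteqP; split=> [x xab j _|x xab j]; have := xab j; rewrite /= in_itv/=; auto.
Qed.

Lemma itv_lty (a b : R) : @lebesgue_measure R `[a, b]%classic < +oo.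
Proof. by rewrite lebesgue_measure_itv/=; case: ifP => // _; rewrite -EFinB ltry. Qed.

Lemma box_prod_lty n (a1 b1 : R) (a b : n.-tuple R) :
  lebesgue_rn R n (box a b) < +oo ->
  (lebesgue_measure \x lebesgue_rn R n)%E (`[a1, b1]%classic `*` box a b) < +oo.
Proof.
move=> Boo; rewrite product_measure1E; [|exact: measurable_itv|exact: measurable_box].
rewrite lte_mul_pinfty ?measure_ge0//.
have : @lebesgue_measure R `[a1, b1]%classic \is a fin_num; last by [].
by rewrite lebesgue_measure_itv/=; case: ifP.
Qed.

Lemma box_lty n (a b : n.-tuple R) : lebesgue_rn R n (box a b) < +oo.
Proof.
elim: n a b => [|n IH] a b.
  by rewrite /= /dirac ltry.
rewrite -(tcons_eta a) -(tcons_eta b).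
rewrite [X in X < _](_ : _ = (lebesgue_measure \x lebesgue_rn R n)%E
  (`[thead a, thead b]%classic `*` box [tuple of behead a] [tuple of behead b])).
  by apply: box_prod_lty; exact: IH.
by rewrite -preimage_tcons_box.
Qed.

Lemma integrable_box n (a b : n.-tuple R) (u : n.-tuple R -> R) (M : R) :
  measurable_fun setT u -> (forall x, (`|u x| <= M)%R) ->
  (lebesgue_rn R n).-integrable (box a b) (EFin \o u).
Proof.
move=> mu_ u1; apply: measurable_bounded_integrable.
- exact: measurable_box.
- exact: box_lty.
- exact: measurable_funTS.
exists M; split; first exact: num_real.
by move=> N MN x _ /=; rewrite (le_trans (u1 x))// ltW.
Qed.

Lemma integrable_itv (a b : R) (u : R -> R) (M : R) :
  measurable_fun setT u -> (forall x, (`|u x| <= M)%R) ->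
  (@lebesgue_measure R).-integrable `[a, b] (EFin \o u).
Proof.
move=> mu_ u1; apply: measurable_bounded_integrable => //.
- exact: itv_lty.
- exact: measurable_funTS.
exists M; split; first exact: num_real.
by move=> N MN x _ /=; rewrite (le_trans (u1 x))// ltW.
Qed.

Lemma Rintegral_box_prod n (a1 b1 : R) (a b : n.-tuple R)
    (u : R -> R) (v : n.-tuple R -> R) (F : n.+1.-tuple R -> R) :
  measurable_fun setT u -> (forall x, (`|u x| <= 1)%R) ->
  measurable_fun setT v -> (forall x, (`|v x| <= 1)%R) ->
  measurable_fun setT F -> (forall x1 x, F (tcons (x1, x)) = u x1 * v x)%R ->
  (\int[lebesgue_rn R n.+1]_(x in box (tcons (a1, a)) (tcons (b1, b))) F x =
   (\int[lebesgue_measure]_(x in `[a1, b1]) u x) *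
   \int[lebesgue_rn R n]_(x in box a b) v x)%R.
Proof.
move=> mu_ u1 mv v1 mF FE.
have F1 x : (`|F x| <= 1)%R.
  by rewrite -(tcons_eta x) FE normrM mulr_ile1.
pose I := `[a1, b1]%classic : set R.
pose U := (EFin \o u) \_ I; pose V := (EFin \o v) \_ (box a b).
have iF := integrable_box (tcons (a1, a)) (tcons (b1, b)) mF F1.
have iu : (@lebesgue_measure R).-integrable setT U.
  apply/integrable_restrict => //; first exact: measurable_itv.
  by rewrite setTI; exact: integrable_itv mu_ u1.
have iv : (lebesgue_rn R n).-integrable setT V.
  apply/integrable_restrict => //; first exact: measurable_box.
  by rewrite setTI; exact: integrable_box mv v1.
pose G : R * n.-tuple R -> \bar R := fun z => U z.1 * V z.2.
have GE : ((EFin \o F) \o @tcons R n) \_ (I `*` box a b) = G.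
  apply/funext => -[x1 x]; rewrite /G /U /V !patchE/=.
  have [xI|xI] := boolP (x1 \in I); have [xB|xB] := boolP (x \in box a b).
  - by rewrite mem_set ?FE//; split; rewrite -inE.
  - rewrite memNset ?mule0// => -[_ /=]; rewrite -[box a b x]inE; exact/negP.
  - rewrite memNset ?mul0e// => -[/= + _]; rewrite -[I x1]inE; exact/negP.
  - rewrite memNset ?mule0// => -[/= + _]; rewrite -[I x1]inE; exact/negP.
have mIB : measurable (I `*` box a b).
  by apply: measurableX; [exact: measurable_itv|exact: measurable_box].
have iFt : (lebesgue_measure \x lebesgue_rn R n)%E.-integrable (I `*` box a b)
    (EFin \o (F \o @tcons R n)).
  apply: measurable_bounded_integrable => //.
  - by apply: box_prod_lty; exact: box_lty.
  - by apply: measurable_funTS; apply: measurableT_comp => //; exact: measurable_tcons.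
  exists 1%R; split; first exact: num_real.
  by move=> N MN x _ /=; rewrite (le_trans (F1 _))// ltW.
have iG : (lebesgue_measure \x lebesgue_rn R n)%E.-integrable setT G.
  by rewrite -GE; apply/integrable_restrict => //; rewrite ?setTI.
rewrite /Rintegral.
have -> : \int[lebesgue_rn R n.+1]_(x in box (tcons (a1, a)) (tcons (b1, b))) (F x)%:E
    = \int[(lebesgue_measure \x lebesgue_rn R n)%E]_z G z.
  rewrite -GE -integral_mkcond -preimage_tcons_box.
  apply: (integral_pushforward (@measurable_tcons R n)) => //.
  - exact/measurable_EFinP.
  - by rewrite preimage_tcons_box.
  - exact: measurable_box.
rewrite -integral21_prod_meas1//.
have Ufin : \int[lebesgue_measure]_x U x \is a fin_num by exact: integrable_fin_num.
have Vfin : \int[lebesgue_rn R n]_x V x \is a fin_num by exact: integrable_fin_num.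
rewrite [X in fine X = _](_ : _ = \int[lebesgue_rn R n]_x
    ((fine (\int[lebesgue_measure]_x U x))%:E * V x)); last first.
  apply: eq_integral => x _; rewrite fineK// /fubini_G /G /=.
  rewrite /V patchE; case: ifPn => _.
    rewrite [RHS]muleC -integralZl//.
    by apply: eq_integral => y _; rewrite muleC.
  by rewrite mule0; apply: integral0_eq => y _; rewrite mule0.
rewrite integralZl// fineM//.
by congr (_ * _)%R; rewrite [in RHS]integral_mkcond.
Qed.

End box_theory.

Section oscillation.
Context (R : realType).
Notation mu := (@lebesgue_measure R).

(** The trivial bound b - a, and the bound 2 / |y| given by the primitive. *)
Lemma Rintegral_osc (f F : R -> R) (a b y : R) :
  a < b -> continuous f -> (forall x, `|f x| <= 1) ->
  (y != 0 -> forall x : R, is_derive x (1 : R) F (f x)) ->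
  (y != 0 -> forall x, `|F x| <= `|y|^-1) ->
  `| \int[mu]_(x in `[a, b]) f x | <= (b - a) * decay (b - a) y.
Proof.
move=> ab cf f1 dF F1.
have mf : measurable_fun setT f by exact: continuous_measurable_fun.
have ba : 0 < b - a by rewrite subr_gt0.
have triv : `| \int[mu]_(x in `[a, b]) f x | <= b - a.
  have i1 : mu.-integrable `[a, b] (EFin \o (fun=> 1%R)).
    by apply: (@integrable_itv _ a b (fun=> 1%R) 1) => // x; rewrite normr1.
  have ifn : mu.-integrable `[a, b] (EFin \o (fun x => `|f x|)).
    apply: (@integrable_itv _ a b (fun x => `|f x|) 1) => [|x].
      exact: measurableT_comp.
    by rewrite normr_id.
  apply: (le_trans (le_normr_Rintegral _ _)) => //.
    exact: integrable_itv mf f1.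
  apply: (@le_trans _ _ (\int[mu]_(x in `[a, b]) 1)).
    by apply: le_Rintegral.
  rewrite Rintegral_cst// mul1r.
  have -> : fine (mu `[a, b]%classic) = b - a; last by [].
  by rewrite lebesgue_measure_itv/= lte_fin ab.
rewrite /decay maxEle; case: ifPn => [m|_]; last by rewrite invr1 mulr1.
have y0 : y != 0.
  by apply: contraTN m => /eqP ->; rewrite normr0 mulr0 mul0r -ltNge.
have yp : 0 < `|y| by rewrite normr_gt0.
have cF : continuous F.
  move=> x; apply/differentiable_continuous/derivable1_diffP.
  by have [] := dF y0 x.
rewrite /Rintegral (@continuous_FTC2 _ f F a b ab).
- rewrite -EFinB/= (le_trans (ler_normB _ _))//.
  apply: (@le_trans _ _ (`|y|^-1 + `|y|^-1)); first by rewrite lerD// F1.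
  rewrite le_eqVlt; apply/orP; left; apply/eqP; field.
  by rewrite !gt_eqF.
- by apply: continuous_subspaceT.
- split.
  + by move=> x _; have [] := dF y0 x.
  + exact/cvg_at_right_filter/cF.
  + exact/cvg_at_left_filter/cF.
- by move=> x _; rewrite derive1E; have [_ ->] := dF y0 x.
Qed.

Lemma is_derive_comp_scale (G g : R -> R) (y : R) : y != 0 ->
  (forall x : R, is_derive x (1 : R) G (g x)) ->
  forall x : R, is_derive x (1 : R) (fun x => G (x * y) / y) (g (x * y)).
Proof.
move=> y0 dG x.
have d1 : is_derive x (1 : R) (y \*: (id : R -> R)) (y *: (1 : R)) by exact: is_deriveZ.
have d2 := is_derive1_comp (dG (y *: x)) d1.
have d3 := @is_deriveZ _ _ _ _ y^-1 _ _ _ d2.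
have -> : (fun x => G (x * y) / y) = y^-1 \*: (G \o (y \*: (id : R -> R))).
  by apply/funext => z; rewrite /= /GRing.scale/= mulrC (mulrC y).
apply: is_derive_eq; rewrite /GRing.scale/= mulr1 (mulrC y x).
by rewrite mulrCA mulVf ?mulr1.
Qed.

Lemma Rintegral_cos_bound (a b y : R) : a < b ->
  `| \int[mu]_(x in `[a, b]) cos (x * y) | <= (b - a) * decay (b - a) y.
Proof.
move=> ab; apply: (@Rintegral_osc _ (fun x => sin (x * y) / y)) => //.
- move=> x; apply: continuous_comp; last exact: continuous_cos.
  by apply: cvgMl; exact: cvg_id.
- by move=> x; rewrite ler_norml cos_geN1 cos_le1.
- move=> y0 x; by apply: is_derive_comp_scale => // z; exact: is_derive_sin.
- move=> y0 x; rewrite normrM normfV ler_piMl// ?invr_ge0//.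
  by rewrite ler_norml sin_geN1 sin_le1.
Qed.

Lemma Rintegral_sin_bound (a b y : R) : a < b ->
  `| \int[mu]_(x in `[a, b]) - sin (x * y) | <= (b - a) * decay (b - a) y.
Proof.
move=> ab; apply: (@Rintegral_osc _ (fun x => cos (x * y) / y)) => //.
- move=> x; apply: cvgN; apply: continuous_comp; last exact: continuous_sin.
  by apply: cvgMl; exact: cvg_id.
- by move=> x; rewrite normrN ler_norml sin_geN1 sin_le1.
- move=> y0 x; by apply: (is_derive_comp_scale (g := fun z => - sin z)) => // z; exact: is_derive_cos.
- move=> y0 x; rewrite normrM normfV ler_piMl// ?invr_ge0//.
  by rewrite ler_norml cos_geN1 cos_le1.
Qed.

End oscillation.

Section box_kernel.
Context (R : realType).

Lemma normc_le_Re_Im (z : R[i]) :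
  Normc.normc z <= `|complex.Re z| + `|complex.Im z|.
Proof.
case: z => x y /=; rewrite -[leRHS]ger0_norm ?addr_ge0// -sqrtr_sqr ler_sqrt ?sqr_ge0//.
by rewrite sqrrD !real_normK ?num_real// addrAC lerDl mulrn_wge0// mulr_ge0.
Qed.

Lemma abs_Re_le_normc (z : R[i]) : `|complex.Re z| <= Normc.normc z.
Proof.
by case: z => x y /=; rewrite -sqrtr_sqr ler_sqrt ?addr_ge0 ?sqr_ge0// lerDl sqr_ge0.
Qed.

Lemma abs_Im_le_normc (z : R[i]) : `|complex.Im z| <= Normc.normc z.
Proof.
by case: z => x y /=; rewrite -sqrtr_sqr ler_sqrt ?addr_ge0 ?sqr_ge0// lerDr sqr_ge0.
Qed.

Lemma normc_ge0 (z : R[i]) : 0 <= Normc.normc z.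
Proof. by case: z => x y /=; exact: sqrtr_ge0. Qed.

(** The integral of the character over the box, that is the Fourier transform of
   its indicator function. *)
Definition box_kernel n (a b y : n.-tuple R) : R[i] :=
  cintegral (box a b) (fun x => expNi (dot x y)).

Definition side n (a b : n.-tuple R) : n.-tuple R :=
  [tuple tnth b j - tnth a j | j < n].

Lemma dot_tcons n (x1 y1 : R) (x y : n.-tuple R) :
  dot (tcons (x1, x)) (tcons (y1, y)) = x1 * y1 + dot x y.
Proof.
rewrite /dot big_ord_recl !tnth_tcons0; congr (_ + _).
by apply: eq_bigr => j _; rewrite !tnth_tconsS.
Qed.

Lemma side_tcons n (a1 b1 : R) (a b : n.-tuple R) :
  side (tcons (a1, a)) (tcons (b1, b)) = tcons (b1 - a1, side a b).
Proof.
apply: eq_from_tnth => j; rewrite tnth_mktuple.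
case: (unliftP ord0 j) => [k|] ->; first by rewrite !tnth_tconsS tnth_mktuple.
by rewrite !tnth_tcons0.
Qed.

Lemma measurable_dot2 n :
  measurable_fun setT (fun z : n.-tuple R * n.-tuple R => dot z.2 z.1).
Proof.
apply: measurable_sum => j; apply: measurable_funM.
  exact: (measurableT_comp (measurable_tnth j) measurable_snd).
exact: (measurableT_comp (measurable_tnth j) measurable_fst).
Qed.

Lemma measurable_dot n (y : n.-tuple R) : measurable_fun setT (fun x => dot x y).
Proof.
apply: measurable_sum => j; apply: measurable_funM; first exact: measurable_tnth.
exact: measurable_cst.
Qed.

(** Adding 1 to h makes the integrand nonnegative, so that Tonelli gives
   measurability in the parameter y without any integrability in y. *)
Lemma measurable_Rintegral_dot n (a b : n.-tuple R) (h : R -> R) :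
  measurable_fun setT h -> (forall s, `|h s| <= 1) ->
  measurable_fun setT
    (fun y : n.-tuple R => \int[lebesgue_rn R n]_(x in box a b) h (dot x y)).
Proof.
move=> mh h1.
have mhy (y : n.-tuple R) : measurable_fun setT (fun x => h (dot x y)).
  exact: (measurableT_comp mh (@measurable_dot n y)).
pose f (z : n.-tuple R * n.-tuple R) : \bar R :=
  ((1 + h (dot z.2 z.1)) * \1_(box a b) z.2)%:E.
have f0 z : (0 <= f z)%E.
  rewrite lee_fin mulr_ge0// -lerBlDl sub0r.
  by have := h1 (dot z.2 z.1); rewrite ler_norml => /andP[].
have mf : measurable_fun setT f.
  apply/measurable_EFinP; apply: measurable_funM.
    apply: measurable_funD; first exact: measurable_cst.
    exact: (measurableT_comp mh (@measurable_dot2 n)).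
  have mi : measurable_fun setT (\1_(box a b) : n.-tuple R -> R).
    by apply: measurable_indic; exact: measurable_box.
  exact: (measurableT_comp mi measurable_snd).
rewrite (_ : (fun _ => _) = (fun y => fine (fubini_F (lebesgue_rn R n) f y) -
    \int[lebesgue_rn R n]_(x in box a b) 1)).
  apply: measurable_funB; last exact: measurable_cst.
  apply: (@measurableT_comp _ _ _ _ _ _ fine); first exact: fine_measurable.
  exact: (measurable_fun_fubini_tonelli_F _ mf f0).
apply/funext => y.
have -> : fine (fubini_F (lebesgue_rn R n) f y) =
    \int[lebesgue_rn R n]_(x in box a b) (1 + h (dot x y)).
  rewrite /Rintegral /fubini_F; congr fine; rewrite [RHS]integral_mkcond.
  apply: eq_integral => x _; rewrite /f /= patchE indicE.
  by case: ifPn => _; rewrite ?mulr1 ?mulr0.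
rewrite -RintegralB.
- by apply: eq_Rintegral => x _; rewrite addrC addKr.
- exact: measurable_box.
- apply: (@integrable_box _ _ _ _ _ 2).
    by apply: measurable_funD => //; exact: measurable_cst.
  by move=> x; rewrite (le_trans (ler_normD _ _))// normr1 -[leRHS]/(1 + 1) lerD2l.
- by apply: (@integrable_box _ _ _ _ _ 1) => // x; rewrite normr1.
Qed.

Lemma measurable_Nsin : measurable_fun setT (fun s : R => - sin s).
Proof.
apply: continuous_measurable_fun => x; apply: cvgN; exact: continuous_sin.
Qed.

Lemma measurable_cosr : measurable_fun setT (@cos R).
Proof. apply: continuous_measurable_fun; exact: continuous_cos. Qed.

Lemma cos_abs_le1 (s : R) : `|cos s| <= 1.
Proof. by rewrite ler_norml cos_geN1 cos_le1. Qed.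

Lemma Nsin_abs_le1 (s : R) : `|- sin s| <= 1.
Proof. by rewrite normrN ler_norml sin_geN1 sin_le1. Qed.

Lemma measurable_Re_box_kernel n (a b : n.-tuple R) :
  measurable_fun setT (fun y => complex.Re (box_kernel a b y)).
Proof. exact: (measurable_Rintegral_dot a b measurable_cosr cos_abs_le1). Qed.

Lemma measurable_Im_box_kernel n (a b : n.-tuple R) :
  measurable_fun setT (fun y => complex.Im (box_kernel a b y)).
Proof. exact: (measurable_Rintegral_dot a b measurable_Nsin Nsin_abs_le1). Qed.

(** The character of a sum is the product of the characters, so the integral over
   a box factors; the addition formulas for cos and sin are the real and
   imaginary parts of this. *)
Lemma box_kernel_tcons n (a1 b1 y1 : R) (a b y : n.-tuple R) :
  box_kernel (tcons (a1, a)) (tcons (b1, b)) (tcons (y1, y)) =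
  Complex (\int[lebesgue_measure]_(x in `[a1, b1]) cos (x * y1))
          (\int[lebesgue_measure]_(x in `[a1, b1]) - sin (x * y1)) * box_kernel a b y.
Proof.
have mc : measurable_fun setT (fun x : R => cos (x * y1)).
  by apply: (measurableT_comp measurable_cosr); apply: measurable_funM.
have ms : measurable_fun setT (fun x : R => - sin (x * y1)).
  by apply: (measurableT_comp measurable_Nsin); apply: measurable_funM.
have mc' : measurable_fun setT (fun x : n.-tuple R => cos (dot x y)).
  exact: (measurableT_comp measurable_cosr (@measurable_dot n y)).
have ms' : measurable_fun setT (fun x : n.-tuple R => - sin (dot x y)).
  exact: (measurableT_comp measurable_Nsin (@measurable_dot n y)).
have c1 x := cos_abs_le1 (x * y1); have s1 x := Nsin_abs_le1 (x * y1).
have c1' x := cos_abs_le1 (dot x y); have s1' x := Nsin_abs_le1 (dot x y).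
pose P (u : R -> R) (v : n.-tuple R -> R) (x : n.+1.-tuple R) : R :=
  u (thead x) * v [tuple of behead x].
have mP (u : R -> R) (v : n.-tuple R -> R) : measurable_fun setT u -> measurable_fun setT v -> measurable_fun setT (P u v).
  move=> mu_ mv; apply: measurable_funM.
    exact: (measurableT_comp mu_ (@measurable_tnth _ R n.+1 ord0)).
  by apply: measurableT_comp => //; exact: measurable_behead.
have P1 (u : R -> R) (v : n.-tuple R -> R) x : (forall x, `|u x| <= 1) -> (forall x, `|v x| <= 1) -> `|P u v x| <= 1.
  by move=> u1 v1; rewrite /P normrM mulr_ile1.
have PE (u : R -> R) (v : n.-tuple R -> R) : measurable_fun setT u -> measurable_fun setT v ->
    (forall x, `|u x| <= 1) -> (forall x, `|v x| <= 1) ->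
    \int[lebesgue_rn R n.+1]_(x in box (tcons (a1, a)) (tcons (b1, b))) P u v x =
    (\int[lebesgue_measure]_(x in `[a1, b1]) u x) *
    \int[lebesgue_rn R n]_(x in box a b) v x.
  move=> mu_ mv u1 v1; apply: Rintegral_box_prod => //; first exact: mP.
  by move=> x1 x; rewrite /P thead_tcons behead_tcons.
have iP (u : R -> R) (v : n.-tuple R -> R) : measurable_fun setT u -> measurable_fun setT v ->
    (forall x, `|u x| <= 1) -> (forall x, `|v x| <= 1) ->
    (lebesgue_rn R n.+1).-integrable (box (tcons (a1, a)) (tcons (b1, b))) (EFin \o P u v).
  by move=> mu_ mv u1 v1; apply: (@integrable_box _ _ _ _ _ 1) => [|x]; [exact: mP|exact: P1].
have mB := measurable_box (tcons (a1, a)) (tcons (b1, b)).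
rewrite {1}/box_kernel /cintegral /=.
rewrite [RHS]/GRing.mul/=; congr Complex.
- rewrite -!PE// -RintegralB//; [|exact: iP|exact: iP].
  apply: eq_Rintegral => x _; rewrite -{1}(tcons_eta x) dot_tcons cosD /P.
  by rewrite mulrNN.
- rewrite -!PE// -RintegralD//; [|exact: iP|exact: iP].
  apply: eq_Rintegral => x _; rewrite -{1}(tcons_eta x) dot_tcons sinD /P.
  by rewrite mulrN mulNr opprD addrC.
Qed.

(** Each factor is bounded through its real and imaginary parts, whence the
   constant 2 per coordinate. *)
Lemma normc_box_kernel_le n (a b y : n.-tuple R) :
  (forall j, tnth a j < tnth b j) ->
  Normc.normc (box_kernel a b y) <=
  2 ^+ n * (\prod_(j < n) (tnth b j - tnth a j)) * mdecay (side a b) y.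
Proof.
elim: n a b y => [|n IH] a b y ab.
  rewrite /mdecay !big_ord0 expr0 !mulr1.
  apply: (le_trans (normc_le_Re_Im _)); rewrite /box_kernel /cintegral /= /Rintegral.
  have bT : box a b = setT by apply/seteqP; split => // x _ [].
  have mS : measurable_fun setT (fun x : 0.-tuple R => (- sin (dot x y))%:E).
    by apply/measurable_EFinP; exact: (measurableT_comp measurable_Nsin (@measurable_dot 0 y)).
  have mC : measurable_fun setT (fun x : 0.-tuple R => (cos (dot x y))%:E).
    by apply/measurable_EFinP; exact: (measurableT_comp measurable_cosr (@measurable_dot 0 y)).
  rewrite bT !integral_dirac//.
  rewrite /dot !big_ord0 cos0 sin0 diracT.
  by rewrite !mul1e/= oppr0 normr0 normr1 addr0.
have ab' j : tnth [tuple of behead a] j < tnth [tuple of behead b] j.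
  by rewrite !tnth_beheadS.
have := ab ord0; rewrite -(tcons_eta a) -(tcons_eta b) -(tcons_eta y) !tnth_tcons0 => ab0.
rewrite box_kernel_tcons Normc.normcM side_tcons mdecay_tcons.
rewrite big_ord_recl !tnth_tcons0 exprS.
have -> : \prod_(i < n) (tnth (tcons (thead b, [tuple of behead b])) (lift ord0 i) -
   tnth (tcons (thead a, [tuple of behead a])) (lift ord0 i)) =
   \prod_(i < n) (tnth [tuple of behead b] i - tnth [tuple of behead a] i).
  by apply: eq_bigr => i _; rewrite !tnth_tconsS.
set c1 := thead b - thead a; set k1 := decay c1 (thead y).
set P := \prod_(i < n) _; set K := mdecay _ _.
rewrite (_ : _ * _ * _ = (2 * (c1 * k1)) * (2 ^+ n * P * K)); last by ring.
apply: ler_pM; rewrite ?normc_ge0//; last exact: IH.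
apply: (le_trans (normc_le_Re_Im _)); rewrite /= mulr_natl mulr2n.
by rewrite lerD// ?Rintegral_cos_bound ?Rintegral_sin_bound.
Qed.

End box_kernel.

(** * Measurability for the completed measure *)

Section completion.
Context d (T : measurableType d) (R : realType) (mu : {measure set T -> \bar R}).
Implicit Types A : set T.

(** The completed algebra consists of the sets which agree with a Borel set off a
   negligible set; in this form complements and countable unions are
   immediate. *)
Lemma completed_algebra_genP A : completed_algebra_gen mu A <->
  exists B N, [/\ measurable B, mu.-negligible N &
    forall x, ~ N x -> (A x <-> B x)].
Proof.
split=> [[B mB [N nN <-]]|[B [N [mB nN AB]]]].
  by exists B, N; split => // x Nx; split=> [[]//|]; left.
have [M [mM M0 NM]] := nN.
exists (B `\` M); first exact: measurableD.
exists (A `&` M).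
  by exists M; split => // x [].
apply/seteqP; split => [x [[Bx Mx]|[]//]|x Ax].
  by apply/(AB x) => // /NM.
have [Mx|Mx] := pselect (M x); first by right.
by left; split => //; apply/(AB x) => // /NM.
Qed.

Lemma sigma_algebra_completed : sigma_algebra setT (completed_algebra_gen mu).
Proof.
split.
- by exists set0 => //; exists set0; [exact: negligible_set0|rewrite setU0].
- move=> A /completed_algebra_genP[B [N [mB nN AB]]]; rewrite setTD.
  apply/completed_algebra_genP; exists (~` B), N; split => //.
    exact: measurableC.
  by move=> x /AB ABx; split => /= h ?; apply: h; apply/ABx.
- move=> A mA.
  have BN0 n : exists BN : set T * set T, [/\ measurable BN.1, mu.-negligible BN.2 &
      forall x, ~ BN.2 x -> (A n x <-> BN.1 x)].
    by have /completed_algebra_genP[B [N BN]] := mA n; exists (B, N).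
  have [BN BNP] := choice BN0; apply/completed_algebra_genP.
  exists (\bigcup_n (BN n).1), (\bigcup_n (BN n).2); split.
  + by apply: bigcupT_measurable => n; have [] := BNP n.
  + by apply: negligible_bigcup => n; have [] := BNP n.
  + move=> x Nx; split => -[n _ Ax]; exists n => //; have [_ _ AB] := BNP n;
      by apply/(AB x) => // Nnx; apply: Nx; exists n.
Qed.

Lemma completed_measurable_fun (f : T -> R) :
  (forall B, measurable B -> completed_algebra_gen mu (f @^-1` B)) <->
  measurable_fun (setT : set (g_sigma_algebraType (completed_algebra_gen mu))) f.
Proof.
split=> [mf _ B mB|mf B mB].
  by rewrite setTI; apply: sub_sigma_algebra; exact: mf.
have := mf measurableT B mB; rewrite setTI /measurable/=.
by rewrite sigma_algebra_id//; exact: sigma_algebra_completed.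
Qed.

Lemma borel_completed_measurable_fun (f : T -> R) : measurable_fun setT f ->
  measurable_fun (setT : set (g_sigma_algebraType (completed_algebra_gen mu))) f.
Proof.
move=> mf; apply/completed_measurable_fun => B mB.
exists (f @^-1` B); first by rewrite -[X in measurable X]setTI; exact: mf.
by exists set0; [exact: negligible_set0|rewrite setU0].
Qed.

End completion.

(** The real and imaginary parts of a product are polynomials in those of
   the factors, and the sets of the completion form a sigma-algebra. *)
Lemma clebesgue_measurableM (R : realType) n (F G : n.-tuple R -> R[i]) :
  clebesgue_measurable F ->
  measurable_fun setT (fun x => complex.Re (G x)) ->
  measurable_fun setT (fun x => complex.Im (G x)) ->
  clebesgue_measurable (fun x => F x * G x).
Proof.
move=> [/completed_measurable_fun mr /completed_measurable_fun mi] gr gi.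
have {}gr := borel_completed_measurable_fun (mu := lebesgue_rn R n) gr.
have {}gi := borel_completed_measurable_fun (mu := lebesgue_rn R n) gi.
split; apply/completed_measurable_fun.
  rewrite (_ : (fun _ => _) = (fun x =>
    complex.Re (F x) * complex.Re (G x) - complex.Im (F x) * complex.Im (G x))).
    by apply: measurable_funB; apply: measurable_funM.
  by apply/funext => x; case: (F x) (G x) => a b [].
rewrite (_ : (fun _ => _) = (fun x =>
  complex.Re (F x) * complex.Im (G x) + complex.Im (F x) * complex.Re (G x))).
  by apply: measurable_funD; apply: measurable_funM.
by apply/funext => x; case: (F x) (G x) => a b [].
Qed.

(** * The norm inequality *)

Section decay_transform.
Local Open Scope ereal_scope.
Context (R : realType) (n : nat).
Implicit Types (phi g : n.-tuple R -> \bar R) (t : n.-tuple R).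

(** The integral of phi against the kernel, when phi is measurable.  For a phi
   that is not Borel, the supremum over the Borel functions below it keeps
   Tonelli applicable. *)
Definition decay_transform phi t : \bar R :=
  ereal_sup [set \int[lebesgue_rn R n]_x (g x * (mdecay t x)%:E) |
    g in [set g | measurable_fun setT g /\ (forall x, 0 <= g x <= phi x)]].

Lemma decay_transform_ge0 phi t : (forall x, 0 <= phi x) ->
  0 <= decay_transform phi t.
Proof.
move=> phi0; apply: (@le_trans _ _ (\int[lebesgue_rn R n]_x (cst 0 x * (mdecay t x)%:E))).
  by apply: integral_ge0 => x _; rewrite mul0e.
apply: ereal_sup_ubound; exists (cst 0) => //; split; first exact: measurable_cst.
by move=> x /=; rewrite lexx phi0.
Qed.

Lemma mdecay_anti (s t x : n.-tuple R) : (forall j, (tnth s j <= tnth t j)%R) ->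
  (mdecay t x <= mdecay s x)%R.
Proof.
by move=> st; apply: ler_prod => j _; rewrite decay_ge0 decay_anti.
Qed.

Lemma decay_transform_anti phi s t : (forall j, (tnth s j <= tnth t j)%R) ->
  decay_transform phi t <= decay_transform phi s.
Proof.
move=> st; apply: ge_ereal_sup => _ [g [mg g0] <-].
apply: (@le_trans _ _ (\int[lebesgue_rn R n]_x (g x * (mdecay s x)%:E))).
  apply: ge0_le_integralT => x; have /andP[g0x _] := g0 x.
    by rewrite mule_ge0// lee_fin ltW// mdecay_gt0.
  by rewrite lee_wpmul2l// lee_fin mdecay_anti.
by apply: ereal_sup_ubound; exists g.
Qed.

(** A Borel function below c phi (kernel) is c (kernel) times a Borel function
   below phi, as the kernel does not vanish. *)
Lemma integral_le_decay_transform phi (H : n.-tuple R -> \bar R) t (c : R) :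
  (0 < c)%R -> (forall x, 0 <= H x) ->
  (forall x, H x <= c%:E * (phi x * (mdecay t x)%:E)) ->
  \int[lebesgue_rn R n]_x H x <= c%:E * decay_transform phi t.
Proof.
move=> c0 H0 Hphi; apply: ge0_integral_le => // h mh h0 hH.
(* The quotient h / w is a Borel function below phi. *)
pose w x := (c * mdecay t x)%R.
have w0 x : (0 < w x)%R by rewrite mulr_gt0// mdecay_gt0.
pose g x := ((w x)^-1 * h x)%:E.
have mg : measurable_fun setT g.
  apply/measurable_EFinP; apply: measurable_funM => //.
  rewrite (_ : (fun _ => _) = (fun x => c^-1 * (mdecay t x)^-1)%R); last first.
    by apply/funext => x; rewrite /w invfM.
  by apply: measurable_funM; [exact: measurable_cst|exact: measurable_mdecayV].
have -> : \int[lebesgue_rn R n]_x (h x)%:E =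
    c%:E * \int[lebesgue_rn R n]_x (g x * (mdecay t x)%:E).
  rewrite -ge0_integralZ_lower//; last first.
    by move=> x _; rewrite mule_ge0 ?lee_fin ?mulr_ge0 ?invr_ge0 ?(ltW (w0 x)) ?(ltW (mdecay_gt0 _ _)).
  apply: eq_integral => x _; rewrite /g -!EFinM /w; congr _%:E.
  by field; rewrite !gt_eqF// mdecay_gt0.
rewrite lee_wpmul2l ?lee_fin ?(ltW c0)//; apply: ereal_sup_ubound.
exists g => //; split => // x.
rewrite lee_fin mulr_ge0 ?invr_ge0 ?(ltW (w0 x))//= /g EFinM lee_pdivrMl//.
by apply: (le_trans (hH x)); apply: (le_trans (Hphi x)); rewrite /w EFinM -muleA (muleC (phi x)).
Qed.

End decay_transform.

Section main_estimate.
Local Open Scope ereal_scope.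
Context (R : realType).

(** The norm inequality for the absolutely convergent majorant: the pointwise
   bound [integral_mdecay_le_sup], whose index set is countable, then
   [mixed_norm_sup] and [mixed_norm_tdiv_le]. *)
Lemma mixed_norm_decay_transform n (p : n.-tuple R) (q : n.-tuple (\bar R)) :
  (forall j, 1 < tnth p j)%R -> qpos q ->
  exists2 C : R, (0 < C)%R & forall phi : n.-tuple R -> \bar R, (forall x, 0 <= phi x) ->
    mixed_norm q (fun t => (powprod (coinv_exp p) t)%:E * decay_transform phi t) <=
    C%:E * mixed_norm q (fun t => (powprod (inv_exp p) t)%:E * rearrange phi t).
Proof.
move=> p1 q0.
have [B B0 HB] := integral_mdecay_le_sup p1.
have [C1 C10 HC1] := mixed_norm_sup (midx0 n) q0 (weights_mweight p1).
have e0 j : (0 <= tnth (inv_exp p) j)%R.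
  by rewrite tnth_mktuple invr_ge0; have := p1 j; lra.
have [C2 C20 HC2] := mixed_norm_tdiv_le q0 e0.
(* B comes from the pointwise bound, C1 from the norm of the supremum and C2
from the change of variables. *)
exists (B * (C1 * C2))%R => [|phi phi0]; first by rewrite !mulr_gt0.
have r0 : nonneg (rearrange phi) by move=> t _; exact: rearrange_ge0.
have ranti : antitone (rearrange phi) by move=> s t _; exact: rearrange_anti.
have T0 : nonneg (fun t => (powprod (coinv_exp p) t)%:E * decay_transform phi t).
  move=> t t0; rewrite mule_ge0 ?decay_transform_ge0// lee_fin ltW//.
  exact: powprod_gt0.
have BV0 : (0 < B^-1)%R by rewrite invr_gt0.
rewrite EFinM -muleA -lee_pdivrMl// -mixed_normZ//.
pose psi (k : midx n) t := (powprod (inv_exp p) (tdiv (mdilation R k) t))%:E *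
        rearrange phi (tdiv (mdilation R k) t).
apply: (le_trans (HC1 psi _ _ _ _ _)).
- by move=> k; apply: mixed_measurable_tdiv => //; exact: tpos_mdilation.
- move=> k t t0; have it0 := tpos_tdiv (tpos_mdilation R k) t0.
  by rewrite mule_ge0 ?rearrange_ge0// lee_fin ltW// powprod_gt0.
- by move=> t t0; rewrite mule_ge0 ?T0// lee_fin ltW.
- move=> t t0; rewrite lee_pdivrMl//.
  rewrite -lee_pdivlMl ?powprod_gt0//; apply: ge_ereal_sup => _ [g [mg g0] <-].
  rewrite lee_pdivlMl ?powprod_gt0//; apply: HB => //.
    by move=> x; have /andP[] := g0 x.
  move=> k; apply: (@le_trans _ _ ((mweight p k)%:E * psi k t)).
    have it0 := tpos_tdiv (tpos_mdilation R k) t0.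
    rewrite !lee_wpmul2l ?lee_fin ?(ltW (powprod_gt0 _ it0)) ?(ltW (mweight_gt0 _ _))//.
    by apply: le_rearrange => x; have /andP[] := g0 x.
  by apply: ereal_sup_ubound; exists k.
rewrite EFinM -muleA lee_wpmul2l ?lee_fin ?(ltW C10)//.
apply: ge_ereal_sup => _ [k _ <-].
exact: (HC2 _ _ (tpos_mdilation R k) r0 ranti).
Qed.

End main_estimate.

Section fourier_bounds.
Local Open Scope ereal_scope.
Context (R : realType) (n : nat).
Implicit Types (f : n.-tuple R -> R[i]) (a b t : n.-tuple R).

Definition absc f : n.-tuple R -> \bar R := fun x => (Normc.normc (f x))%:E.

Lemma absc_ge0 f x : 0 <= absc f x.
Proof. by rewrite lee_fin normc_ge0. Qed.

Definition volume a b : R := \prod_(j < n) (tnth b j - tnth a j).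

Lemma volume_gt0 a b : (forall j, tnth a j < tnth b j)%R -> (0 < volume a b)%R.
Proof. by move=> ab; apply: prodr_gt0 => j _; rewrite subr_gt0. Qed.

Lemma integral_absc_fourier_le f a b t : (forall j, tnth a j < tnth b j)%R ->
  (forall j, tnth t j <= tnth b j - tnth a j)%R ->
  \int[lebesgue_rn R n]_y (Normc.normc (fourier_integrand f (box a b) y))%:E <=
  (2 ^+ n * volume a b)%:E * decay_transform (absc f) t.
Proof.
move=> ab tab; apply: integral_le_decay_transform.
- by rewrite mulr_gt0// ?exprn_gt0// volume_gt0.
- by move=> y; rewrite lee_fin normc_ge0.
move=> y; rewrite /fourier_integrand Normc.normcM /absc -!EFinM lee_fin.
rewrite mulrCA ler_wpM2l ?normc_ge0//.
apply: (le_trans (normc_box_kernel_le y ab)); rewrite -/(volume a b).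
rewrite ler_wpM2l//; first by rewrite mulr_ge0 ?exprn_ge0// ltW// volume_gt0.
by apply: mdecay_anti => j; rewrite tnth_mktuple.
Qed.

(** Stated through all functions G below |F|, because F is only Lebesgue
   measurable; the positive and negative parts are two such functions. *)
Lemma abs_Rintegral_le (F : n.-tuple R -> R) (Y : \bar R) :
  (forall G : n.-tuple R -> \bar R, (forall x, 0 <= G x <= `|F x|%:E) ->
    \int[lebesgue_rn R n]_x G x <= Y) ->
  `| \int[lebesgue_rn R n]_x F x |%:E <= Y.
Proof.
move=> FY; have Y0 : 0 <= Y.
  apply: (@le_trans _ _ (\int[lebesgue_rn R n]_x cst 0 x)); first exact: integral_ge0.
  by apply: FY => x; apply/andP; split; rewrite ?lexx// lee_fin.
have P0 : 0 <= \int[lebesgue_rn R n]_x (fun x => (F x)%:E)^\+ x.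
  by apply: integral_ge0 => x _; exact: funepos_ge0.
have N0 : 0 <= \int[lebesgue_rn R n]_x (fun x => (F x)%:E)^\- x.
  by apply: integral_ge0 => x _; exact: funeneg_ge0.
have PY : \int[lebesgue_rn R n]_x (fun x => (F x)%:E)^\+ x <= Y.
  apply: FY => x; rewrite funepos_ge0 -abse_EFin.
  by rewrite -[leRHS]/((abse \o (fun x => (F x)%:E)) x) fune_abse leeDl// funeneg_ge0.
have NY : \int[lebesgue_rn R n]_x (fun x => (F x)%:E)^\- x <= Y.
  apply: FY => x; rewrite funeneg_ge0 -abse_EFin.
  by rewrite -[leRHS]/((abse \o (fun x => (F x)%:E)) x) fune_abse leeDr// funepos_ge0.
rewrite /Rintegral integralE.
move: P0 N0 PY NY; move: (\int[_]_x _^\+ x) (\int[_]_x _^\- x) => P N P0 N0 PY NY.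
case: Y Y0 {FY} PY NY => [y| |] // Y0 PY NY; last by rewrite leey.
case: P P0 PY => [P| |] // P0 PY; case: N N0 NY => [N| |] // N0 NY.
rewrite !lee_fin in Y0 P0 N0 PY NY *.
by rewrite ler_norml; apply/andP; split; rewrite /=; lra.
Qed.

Lemma normc_fourier_integral_le f a b t : (forall j, tnth a j < tnth b j)%R ->
  (forall j, tnth t j <= tnth b j - tnth a j)%R ->
  (Normc.normc (fourier_integral f (box a b)))%:E <=
  (2 ^+ n.+1 * volume a b)%:E * decay_transform (absc f) t.
Proof.
move=> ab tab; set Y := decay_transform _ _.
have HY (G : n.-tuple R -> \bar R) :
    (forall x, 0 <= G x <= (Normc.normc (fourier_integrand f (box a b) x))%:E) ->
    \int[lebesgue_rn R n]_x G x <= (2 ^+ n * volume a b)%:E * Y.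
  move=> HG; apply: le_trans (integral_absc_fourier_le f ab tab).
  by apply: ge0_le_integralT => x; have /andP[] := HG x.
apply: (@le_trans _ _ (`| complex.Re (fourier_integral f (box a b)) |%:E +
   `| complex.Im (fourier_integral f (box a b)) |%:E)).
  by rewrite -EFinD lee_fin normc_le_Re_Im.
have -> : (2 ^+ n.+1 * volume a b)%:E * Y =
    (2 ^+ n * volume a b)%:E * Y + (2 ^+ n * volume a b)%:E * Y.
  rewrite -ge0_muleDl -?EFinD ?lee_fin ?mulr_ge0 ?exprn_ge0 ?(ltW (volume_gt0 ab))//.
  by congr (_%:E * _); rewrite exprS; ring.
apply: leeD; apply: abs_Rintegral_le => G HG; apply: HY => x;
  have /andP[-> /le_trans] := HG x; apply; rewrite lee_fin.
- exact: abs_Re_le_normc.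
- exact: abs_Im_le_normc.
Qed.

Lemma avg_sup_le f t : tpos t ->
  avg_sup (fourier_integral f) t <= (2 ^+ n.+1)%:E * decay_transform (absc f) t.
Proof.
move=> t0; apply: ge_ereal_sup => _ [[a b] /= ab <-].
have ab1 j : (tnth a j < tnth b j)%R by have [] := ab j.
have ab2 j : (tnth t j <= tnth b j - tnth a j)%R by have [_ /ltW] := ab j.
rewrite EFinM lee_pdivrMl ?volume_gt0//.
apply: (le_trans (normc_fourier_integral_le f ab1 ab2)).
by rewrite (mulrC (2 ^+ n.+1)%R) EFinM -muleA.
Qed.

Lemma avg_sup_ge0 (J : set (n.-tuple R) -> R[i]) t : tpos t -> 0 <= avg_sup J t.
Proof.
move=> t0; set b := [tuple (tnth t j + 1)%R | j < n].
apply: (@le_trans _ _ ((\prod_(j < n) (tnth b j - tnth [tuple 0%R | j < n] j))^-1 *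
          Normc.normc (J (box [tuple 0%R | j < n] b)))%:E).
  rewrite lee_fin mulr_ge0 ?normc_ge0// invr_ge0 prodr_ge0// => j _.
  by rewrite !tnth_mktuple subr0 addr_ge0// ltW.
apply: ereal_sup_ubound; exists ([tuple 0%R | j < n], b) => //= j.
by rewrite !tnth_mktuple subr0; have := t0 j; split; lra.
Qed.

(** If it were infinite at t, it would be infinite at all points with
   smaller coordinates, and its mixed norm would be infinite. *)
Lemma decay_transform_lty (p : n.-tuple R) (q : n.-tuple (\bar R)) phi t :
  qpos q -> (forall x, 0 <= phi x) ->
  mixed_norm q (fun t => (powprod (coinv_exp p) t)%:E * decay_transform phi t) < +oo ->
  tpos t -> decay_transform phi t < +oo.
Proof.
move=> q0 phi0 Moo t0; rewrite ltey; apply/negP => /eqP Too.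
(* A common lower bound of the coordinates of t. *)
pose tau := \big[Order.min/1%R]_(j < n) tnth t j.
have tau0 : (0 < tau)%R.
  by apply: (big_ind (fun x : R => 0 < x)%R) => // x y x0 y0; rewrite lt_min x0.
have tauE j : (tau <= tnth t j)%R by exact: bigmin_le.
have : mixed_norm q (fun t => (powprod (coinv_exp p) t)%:E * decay_transform phi t) = +oo.
  apply: (mixed_norm_pinfty q0 tau0) => s s0.
    rewrite mule_ge0 ?decay_transform_ge0// lee_fin ltW//; exact: powprod_gt0.
  move=> st; suff -> : decay_transform phi s = +oo.
    by rewrite gt0_muley// lte_fin powprod_gt0.
  apply/eqP; rewrite -leye_eq -Too; apply: decay_transform_anti => j.
  exact: le_trans (st j) (tauE j).
by move=> E; rewrite E ltxx in Moo.
Qed.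

Lemma lorentz_normE (p : n.-tuple R) (q : n.-tuple (\bar R)) f : qpos q ->
  lorentz_norm p q f =
  mixed_norm q (fun t => (powprod (inv_exp p) t)%:E * rearrange (absc f) t).
Proof.
move=> q0; apply/esym; apply: eq_mixed_norm => //.
  move=> t t0; rewrite mule_ge0 ?rearrange_ge0//; last by move=> x; exact: absc_ge0.
  by rewrite lee_fin ltW// powprod_gt0.
move=> t t0; have -> : powprod (inv_exp p) t = (\prod_(j < n) (tnth t j `^ (tnth p j)^-1))%R.
  by apply: eq_bigr => j _; rewrite tnth_mktuple.
rewrite gee0_abs// mule_ge0 ?rearrange_ge0//; last by move=> x; exact: absc_ge0.
by rewrite lee_fin; apply: prodr_ge0 => j _; exact: powR_ge0.
Qed.

Lemma net_norm_fourier_le (p : n.-tuple R) (q : n.-tuple (\bar R)) f :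
  (forall j, 1 < tnth p j)%R -> qpos q ->
  net_norm (conj_exp p) q (fourier_integral f) <= (2 ^+ n.+1)%:E *
  mixed_norm q (fun t => (powprod (coinv_exp p) t)%:E * decay_transform (absc f) t).
Proof.
move=> p1 q0; rewrite -mixed_normZ// ?exprn_gt0//; last first.
  move=> t t0; rewrite mule_ge0 ?decay_transform_ge0//; last by move=> x; exact: absc_ge0.
  by rewrite lee_fin ltW// powprod_gt0.
apply: le_mixed_norm => // t t0.
have -> : (\prod_(j < n) (tnth t j `^ (tnth (conj_exp p) j)^-1))%R = powprod (coinv_exp p) t.
  apply: eq_bigr => j _; rewrite !tnth_mktuple; congr (_ `^ _)%R.
  by have := p1 j => pj; field; rewrite !gt_eqF//; lra.
have P0 := powprod_gt0 (coinv_exp p) t0.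
rewrite gee0_abs; last by rewrite mule_ge0 ?avg_sup_ge0// lee_fin ltW.
by rewrite muleCA lee_wpmul2l ?lee_fin ?(ltW P0)// avg_sup_le.
Qed.

End fourier_bounds.

Theorem theorem5p2 (R : realType) (n : nat) (p : n.-tuple R)
    (q : n.-tuple (\bar R)) (hn : (0 < n)%N)
    (hp : forall j : 'I_n, 1 < tnth p j)
    (hq : forall j : 'I_n, (0 < tnth q j)%E) :
  exists c : R, 0 < c /\
    forall f : n.-tuple R -> R[i], in_lorentz p q f ->
      fourier_in_net (conj_exp p) q f /\
      (net_norm (conj_exp p) q (fourier_integral f) <=
        c%:E * lorentz_norm p q f)%E.
Proof.
have [C C0 HC] := mixed_norm_decay_transform hp hq.
exists (2 ^+ n.+1 * C); split; first by rewrite mulr_gt0// exprn_gt0.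
move=> f [mf foo].
have phi0 x : (0 <= absc f x)%E by exact: absc_ge0.
have MT := HC _ phi0; rewrite -(lorentz_normE p f hq) in MT.
have Too : (mixed_norm q (fun t => (powprod (coinv_exp p) t)%:E *
    decay_transform (absc f) t) < +oo)%E.
  apply: (le_lt_trans MT); rewrite lte_mul_pinfty ?lee_fin ?(ltW C0)//.
have net : (net_norm (conj_exp p) q (fourier_integral f) <=
    (2 ^+ n.+1 * C)%:E * lorentz_norm p q f)%E.
  apply: (le_trans (net_norm_fourier_le f hp hq)).
  by rewrite EFinM -muleA lee_wpmul2l ?lee_fin ?exprn_ge0.
split=> //; split; last first.
  apply: (le_lt_trans net); rewrite lte_mul_pinfty ?lee_fin//.
  by rewrite mulr_ge0 ?exprn_ge0 ?ltW.
move=> a b ab; split.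
  apply: clebesgue_measurableM => //.
    exact: measurable_Re_box_kernel.
  exact: measurable_Im_box_kernel.
have side0 : tpos (side a b) by move=> j; rewrite tnth_mktuple subr_gt0.
apply: (le_lt_trans (integral_absc_fourier_le f ab (t := side a b) _)).
  by move=> j; rewrite tnth_mktuple.
rewrite lte_mul_pinfty ?lee_fin//.
  by rewrite mulr_ge0 ?exprn_ge0// ltW// volume_gt0.
exact: decay_transform_lty Too side0.
Qed.
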